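(* Let $V$ be a $C_2$-cofinite vertex operator superalgebra and $g$ an automorphism of $V$ of finite order. Then $V$ is $g$-rational if and only if $V$ is $g$-regular.
   Context: A vertex operator superalgebra (VOSA) $V=V_{\bar0}\oplus V_{\bar1}$ has the following structure. - Vertex operators $Y(v,z)=\sum v(n)z^{-n-1}$, vacuum $\mathbf1$, and conformal vector $\omega$ with $Y(\omega,z)=\sum L(n)z^{-n-2}$ (Virasoro). - The super Jacobi identity holds with sign $\epsilon_{u,v}=(-1)^{\tilde u\tilde v}$. - $V=\bigoplus_{n\in\frac12\mathbb Z}V_n$ by $L(0)$-weight, with $V_{\bar0}$ integral and $V_{\bar1}$ half-integral weights. Automorphisms fix $\mathbf1,\omega$ and satisfy $gY(v,z)g^{-1}=Y(gv,z)$. $\sigma$ is the parity automorphism. $C_2$-cofinite means $C_2(V)=\mathrm{span}\{u(-2)v:u,v\in V\}$ has finite codimension. For $g$ of order $T$, $T'$ the order of $g\sigma$, and $V^r=\{v:gv=e^{-2\pi ir/T}v\}$: a weak $g$-twisted module is a space $M$ with $Y_M(v,z)=\sum_{n\in r/T+\mathbb Z}v(n)z^{-n-1}$ for $v\in V^r$, such that $v(m)w=0$ for $m\gg0$, $Y_M(\mathbf1,z)=\mathrm{id}$, and $z_0^{-1}\delta(\frac{z_1-z_2}{z_0})Y_M(u,z_1)Y_M(v,z_2)-\epsilon_{u,v}z_0^{-1}\delta(\frac{z_2-z_1}{-z_0})Y_M(v,z_2)Y_M(u,z_1)=z_2^{-1}(\frac{z_1-z_0}{z_2})^{-r/T}\delta(\frac{z_1-z_0}{z_2})Y_M(Y(u,z_0)v,z_2)$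 for $\mathbb Z_2$-homogeneous $u\in V^r$. An admissible one has a grading $M=\bigoplus_{n\in\frac1{T'}\mathbb Z_{\ge0}}M(n)$ with $v(m)M(n)\subseteq M(n+\mathrm{wt}v-m-1)$. An (ordinary) one has finite-dimensional $L(0)$-eigenspaces $M_\lambda$, $M=\bigoplus M_\lambda$, with $M_{\lambda+n/T'}=0$ for $n\ll0$. $V$ is $g$-rational if every admissible $g$-twisted module is a direct sum of irreducible admissible $g$-twisted modules. $V$ is $g$-regular if every weak $g$-twisted module is a direct sum of irreducible ordinary $g$-twisted modules. *)

(* Defs.v *)
From HB Require Import structures.
From mathcomp Require Import all_boot all_order all_algebra.
From mathcomp Require Import reals trigo complex.
From mathcomp Require Import Rstruct.
Set Implicit Arguments. Unset Strict Implicit. Unset Printing Implicit Defensive.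
Import Order.TTheory GRing.Theory Num.Theory ComplexField.
Local Open Scope ring_scope.

Definition CC : numClosedFieldType := complex Rdefinitions.R.

Definition zeta (T : nat) : CC :=
  Complex (cos (2 * pi / T%:R)) (sin (2 * pi / T%:R)).

Definition binC (a : CC) (i : nat) : CC :=
  (\prod_(j < i) (a - j%:R)) / (i`!)%:R.

Section Generic.
Variable M : lmodType CC.

Definition subspace (S : M -> Prop) : Prop :=
  S 0 /\ forall (a : CC) x y, S x -> S y -> S (a *: x + y).

Definition in_span (s : seq M) (x : M) : Prop :=
  exists c : nat -> CC, x = \sum_(i < size s) c i *: s`_i.

Definition fin_dim (S : M -> Prop) : Prop :=
  exists s : seq M, forall x, S x -> in_span s x.

Definition is_dsum (I : Type) (W : I -> M -> Prop) (S : M -> Prop) : Prop :=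
  (forall i x, W i x -> S x) /\
  (forall x, S x -> exists (s : seq I) (f : I -> M),
        (forall i, W i (f i)) /\ x = \sum_(i <- s) f i) /\
  (forall (s : seq I) (f : I -> M), List.NoDup s -> (forall i, W i (f i)) ->
        \sum_(i <- s) f i = 0 -> forall i, List.In i s -> f i = 0).

Definition linearf (N : lmodType CC) (f : M -> N) : Prop :=
  forall (a : CC) x y, f (a *: x + y) = a *: f x + f y.

(* eventual equality of all sufficiently long truncations of two series
   whose terms are (by the truncation axioms) eventually zero *)
Definition fsum_eq (a b : nat -> M) : Prop :=
  exists N : nat, forall B : nat, (N <= B)%N ->
    \sum_(i < B) a i = \sum_(i < B) b i.

Definition order_of (f : M -> M) (T : nat) : Prop :=
  (0 < T)%N /\ (forall v, iter T f v = v) /\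
  (forall k : nat, (0 < k < T)%N -> exists v, iter k f v <> v).
End Generic.

(* Vertex operator superalgebras.  Modes: Y u n = u(n), n : int.       *)
Section VOSA.
Variable V : lmodType CC.
Variable Y : V -> int -> V -> V.
Variables (vac om : V).

Definition Lop (n : int) : V -> V := Y om (n + 1).

Definition homw (v : V) (d : int) : Prop := Lop 0 v = (d%:~R / 2%:R) *: v.

Definition wspace (d : int) : V -> Prop := fun v => homw v d.

Definition parity (v : V) (b : bool) : Prop :=
  exists (ds : seq int) (f : int -> V),
    (forall d, d \in ds -> homw (f d) d /\ (~~ (2 %| d)%Z) = b) /\
    v = \sum_(d <- ds) f d.

Definition eps (b1 b2 : bool) : CC := (-1) ^+ (b1 && b2).

Definition is_VOSA : Prop :=
  (forall n (a : CC) u u' v, Y (a *: u + u') n v = a *: Y u n v + Y u' n v) /\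
  (forall u n, linearf (Y u n)) /\
  (forall u v, exists N : int, forall n, N <= n -> Y u n v = 0) /\
  (forall n v, Y vac n v = if n == -1 then v else 0) /\
  (forall u, Y u (-1) vac = u) /\
  (forall u n, 0 <= n -> Y u n vac = 0) /\
  (exists c : CC, forall m n v,
     Lop m (Lop n v) - Lop n (Lop m v) =
       (m - n)%:~R *: Lop (m + n) v +
       (if m + n == 0 then ((m ^+ 3 - m)%:~R / 12%:R) * c else 0) *: v) /\
  (forall u n v, Y (Lop (-1) u) n v = - (n%:~R) *: Y u (n - 1) v) /\
  is_dsum wspace (fun _ => True) /\
  (forall d, fin_dim (wspace d)) /\
  (exists d0 : int, forall d v, d < d0 -> homw v d -> v = 0) /\
  (* super Jacobi identity, in components (Borcherds identity) *)
  (forall u v b1 b2, parity u b1 -> parity v b2 -> forall (p q r : int) w,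
     fsum_eq
       (fun i => binC p%:~R i *: Y (Y u (r + i%:Z) v) (p + q - i%:Z) w)
       (fun i => ((-1) ^+ i * binC r%:~R i) *:
          (Y u (p + r - i%:Z) (Y v (q + i%:Z) w)
           - (eps b1 b2 * (-1) ^ r) *: Y v (q + r - i%:Z) (Y u (p + i%:Z) w)))).

Definition C2_span (x : V) : Prop :=
  exists ps : seq (V * V), x = \sum_(p <- ps) Y p.1 (-2) p.2.

Definition C2_cofinite : Prop :=
  exists s : seq V, forall x, exists c : nat -> CC,
    C2_span (x - \sum_(i < size s) c i *: s`_i).

Definition is_automorphism (g : V -> V) : Prop :=
  linearf g /\ bijective g /\ g vac = vac /\ g om = om /\
  (forall u n v, g (Y u n v) = Y (g u) n (g v)).

Definition is_parity_aut (s : V -> V) : Prop :=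
  linearf s /\ forall v b, parity v b -> s v = (if b then - v else v).

Definition eigsp (g : V -> V) (T : nat) (r : int) (v : V) : Prop :=
  g v = (zeta T ^ (- r)) *: v.

(* g-twisted modules.  YM v k denotes the mode v(k/T), k : int.        *)
Section Twisted.
Variables (g : V -> V) (T T' : nat).

Definition is_weak_twisted (M : lmodType CC) (YM : V -> int -> M -> M) : Prop :=
  (forall k (a : CC) u u' w, YM (a *: u + u') k w = a *: YM u k w + YM u' k w) /\
  (forall u k, linearf (YM u k)) /\
  (forall r v k w, eigsp g T r v -> ~~ (T%:Z %| k - r)%Z -> YM v k w = 0) /\
  (forall v w, exists N : int, forall k, N <= k -> YM v k w = 0) /\
  (forall k w, YM vac k w = if k == - T%:Z then w else 0) /\
  (* twisted super Jacobi identity, in components: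
     for u in V^r Z2-homogeneous, m = km/T in r/T+Z, n = kn/T, l in Z *)
  (forall u v r b1 b2, eigsp g T r u -> parity u b1 -> parity v b2 ->
   forall (km kn l : int) w, (T%:Z %| km - r)%Z ->
     fsum_eq
       (fun i => binC (km%:~R / T%:R) i *:
           YM (Y u (l + i%:Z) v) (km + kn - i%:Z * T%:Z) w)
       (fun i => ((-1) ^+ i * binC l%:~R i) *:
          (YM u (km + (l - i%:Z) * T%:Z) (YM v (kn + i%:Z * T%:Z) w)
           - (eps b1 b2 * (-1) ^ l) *:
               YM v (kn + (l - i%:Z) * T%:Z) (YM u (km + i%:Z * T%:Z) w)))).

Section Mod.
Variables (M : lmodType CC) (YM : V -> int -> M -> M).

Definition submodule (W S : M -> Prop) : Prop :=
  subspace W /\ (forall w, W w -> S w) /\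
  (forall v k w, W w -> W (YM v k w)).

(* admissible grading of the submodule S: G j = S(j/T'), j : nat;
   for v of weight d/2, v(k/T) S(j/T') is contained in S(j/T' + d/2 - k/T - 1),
   where S(x) := 0 if x is not in (1/T') Z_{>=0} *)
Definition Gext (G : nat -> M -> Prop) (x : CC) (w : M) : Prop :=
  (exists j : nat, x = j%:R / T'%:R /\ G j w) \/ w = 0.

Definition adm_grading (S : M -> Prop) (G : nat -> M -> Prop) : Prop :=
  (forall j, subspace (G j)) /\ is_dsum G S /\
  (forall v d k j w, homw v d -> G j w ->
     Gext G (j%:R / T'%:R + d%:~R / 2%:R - k%:~R / T%:R - 1) (YM v k w)).

Definition adm_submodule (S : M -> Prop) (G : nat -> M -> Prop)
    (W : M -> Prop) : Prop :=
  submodule W S /\ is_dsum (fun j w => W w /\ G j w) W.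

Definition irr_admissible (S : M -> Prop) : Prop :=
  submodule S (fun _ => True) /\ (exists w, S w /\ w <> 0) /\
  exists G, adm_grading S G /\
    forall W, adm_submodule S G W ->
      (forall w, W w -> w = 0) \/ (forall w, S w -> W w).

Definition LM0 (w : M) : M := YM om T%:Z w.

Definition eigM (S : M -> Prop) (lam : CC) (w : M) : Prop :=
  S w /\ LM0 w = lam *: w.

Definition ordinary (S : M -> Prop) : Prop :=
  is_dsum (eigM S) S /\
  (forall lam, fin_dim (eigM S lam)) /\
  (forall lam, exists n0 : int, forall n w, n < n0 ->
       eigM S (lam + n%:~R / T'%:R) w -> w = 0).

Definition irr_ordinary (S : M -> Prop) : Prop :=
  submodule S (fun _ => True) /\ ordinary S /\ (exists w, S w /\ w <> 0) /\
  forall W, submodule W S ->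
    (forall w, W w -> w = 0) \/ (forall w, S w -> W w).

Definition dsum_of (P : (M -> Prop) -> Prop) : Prop :=
  exists (I : Type) (W : I -> M -> Prop),
    (forall i, P (W i)) /\ is_dsum W (fun _ => True).

Definition admissible : Prop :=
  is_weak_twisted YM /\ exists G, adm_grading (fun _ => True) G.
End Mod.

Definition g_rational : Prop :=
  forall (M : lmodType CC) (YM : V -> int -> M -> M),
    admissible YM -> dsum_of (irr_admissible YM).

Definition g_regular : Prop :=
  forall (M : lmodType CC) (YM : V -> int -> M -> M),
    is_weak_twisted YM -> dsum_of (irr_ordinary YM).
End Twisted.
End VOSA.

(* Main.v *)
(* Let w be a vector of a weak g-twisted module.  Consider words in
   modes of homogeneous g-eigenvectors applied to w, and give each letter of
   weight x the size x + N, where N makes all sizes positive.  Up to words of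
   smaller size, letters super-commute and sums of u(m-j)v(m+j) over all j
   vanish, as these become modes of u(-1)v.  C_2-cofiniteness implies that
   vectors of large weight lie in C_l(V) for every l, and for l large compared
   with N the iterate formula turns a mode of u(-l)v into words of smaller size.
   Hence the words of a given degree are spanned by words with bounded weights
   and bounded, pairwise distinct modes: each degree is finite-dimensional, and
   low degrees vanish.

   So L(0) is locally finite.  A generalized L(0)-eigenvector generates an
   admissible module, graded by the degree of words, which splits by rationality.
   An irreducible admissible module contains an L(0)-eigenvector, so its grading
   is the one by L(0)-eigenvalues and it is ordinary.  A sum of irreducible
   modules is a direct sum of some of them, by Zorn's lemma.

   Conversely, the L(0)-eigenvalues of an irreducible ordinary module lie in one
   coset of (1/T')Z and are bounded below, so the eigenspaces form an admissible
   grading, and a regular V is rational. *)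
From HB Require Import structures.
Require Import Defs.
From mathcomp Require Import all_boot all_order all_algebra.
From mathcomp Require Import boolp classical_sets.
From mathcomp Require Import reals Rstruct trigo complex.
From mathcomp Require Import zify ring lra.
Set Implicit Arguments. Unset Strict Implicit. Unset Printing Implicit Defensive.
Import Order.TTheory GRing.Theory Num.Theory.
Local Open Scope ring_scope.

(** * Subspaces, spans and direct sums *)

(** The two notions of irreducibility are not directly comparable: an irreducible admissible module
    is tested only against graded submodules, an ordinary one against all of them. From rationality
    to regularity they are bridged by [simple_eig], which asks for irreducibility against all
    submodules and for one L(0)-eigenvector, and mentions no grading.

    A weak module carries no grading at the start, so finite dimension is proved for spans of words
    sorted by a formal degree. The rewriting of words terminates by two nested measures: the size,
    and for fixed size the difference [gap_sum x ^+ 2 - gap_sqsum x].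

    Formal degrees lie in (1/2T)Z, whereas the gradings have step 1/T'. The finer information comes
    from the order of g sigma and holds only for modes that do not vanish; hence the repeated case
    distinctions on whether a mode is zero. *)

Section Linearf.
Variables (M N : lmodType CC) (f : M -> N).
Hypothesis lf : linearf f.

Lemma linf0 : f 0 = 0.
Proof.
have := lf 1 0 0; rewrite !scale1r addr0 => h.
by apply: (addrI (f 0)); rewrite -h addr0.
Qed.

Lemma linfD x y : f (x + y) = f x + f y.
Proof. by have := lf 1 x y; rewrite !scale1r. Qed.

Lemma linfZ a x : f (a *: x) = a *: f x.
Proof. by have := lf a x 0; rewrite !addr0 linf0 addr0. Qed.

Lemma linfN x : f (- x) = - f x.
Proof. by rewrite -scaleN1r linfZ scaleN1r. Qed.

Lemma linfB x y : f (x - y) = f x - f y.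
Proof. by rewrite linfD linfN. Qed.

Lemma linf_sum (I : Type) (r : seq I) (p : pred I) (F : I -> M) :
  f (\sum_(i <- r | p i) F i) = \sum_(i <- r | p i) f (F i).
Proof. exact: (big_morph f linfD linf0). Qed.

End Linearf.

Section Hull.
Variable M : lmodType CC.
Implicit Types (P Q S : M -> Prop) (x y : M).

Lemma subspace0 S : subspace S -> S 0.
Proof. by case. Qed.

Lemma subspaceD S x y : subspace S -> S x -> S y -> S (x + y).
Proof. by case=> _ h Sx Sy; rewrite -[x]scale1r; apply: h. Qed.

Lemma subspaceZ S a x : subspace S -> S x -> S (a *: x).
Proof. by case=> h0 h Sx; rewrite -[_ *: _]addr0; apply: h. Qed.

Lemma subspaceN S x : subspace S -> S x -> S (- x).
Proof. by move=> hS Sx; rewrite -scaleN1r; apply: subspaceZ. Qed.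

Lemma subspaceB S x y : subspace S -> S x -> S y -> S (x - y).
Proof. by move=> hS Sx Sy; apply: subspaceD => //; apply: subspaceN. Qed.

Lemma subspace_sum S (I : Type) (r : seq I) (p : pred I) (f : I -> M) :
  subspace S -> (forall i, p i -> S (f i)) -> S (\sum_(i <- r | p i) f i).
Proof.
move=> hS hf; elim/big_rec: _ => [|i x pi Sx]; first exact: subspace0.
by apply: subspaceD => //; apply: hf.
Qed.

Lemma subspace_sum_seq S (I : eqType) (r : seq I) (f : I -> M) :
  subspace S -> (forall i, i \in r -> S (f i)) -> S (\sum_(i <- r) f i).
Proof.
by move=> hS hf; rewrite big_seq; apply: subspace_sum.
Qed.

Lemma subspaceDr S x y : subspace S -> S x -> (S (y + x) <-> S y).
Proof.
move=> hS Sx; split=> h; last exact: subspaceD.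
by rewrite -[y](addrK x); apply: subspaceB.
Qed.

Lemma subspaceI P Q : subspace P -> subspace Q -> subspace (fun x => P x /\ Q x).
Proof.
move=> [P0 hP] [Q0 hQ]; split=> // a x y [Px Qx] [Py Qy].
by split; [apply: hP | apply: hQ].
Qed.

Lemma subspace_zero : subspace (fun x => x = 0).
Proof. by split=> // a x y -> ->; rewrite scaler0 addr0. Qed.

Lemma subspace_true : subspace (fun _ : M => True).
Proof. by split. Qed.

(** The span as an intersection of subspaces: linear claims are checked on generators, and explicit
    sums appear only where independence is used. *)
Variant hull P y : Prop :=
  Hull of (forall S, subspace S -> (forall x, P x -> S x) -> S y).

Lemma hull_subspace P : subspace (hull P).
Proof.
split=> [|a x y [hx] [hy]]; split=> S hS hP; first exact: subspace0.
by case: (hS) => _; apply; [apply: hx | apply: hy].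
Qed.

Lemma hull_gen P x : P x -> hull P x.
Proof. by move=> Px; split=> S _; apply. Qed.

Lemma hull_min P S x : subspace S -> (forall x, P x -> S x) -> hull P x -> S x.
Proof. by move=> hS hP [h]; apply: h. Qed.

Lemma hull_sub P Q x : (forall x, P x -> hull Q x) -> hull P x -> hull Q x.
Proof. by move=> h; apply: hull_min => //; exact: hull_subspace. Qed.

Lemma hull_mono P Q x : (forall x, P x -> Q x) -> hull P x -> hull Q x.
Proof. by move=> h; apply: hull_sub => y /h; apply: hull_gen. Qed.

Lemma subspace_preim (N : lmodType CC) (f : M -> N) (S : N -> Prop) :
  linearf f -> subspace S -> subspace (fun x => S (f x)).
Proof.
move=> lf hS; split=> [|a x y Sx Sy]; last first.
  by rewrite lf; case: hS => _; apply.
by rewrite (linf0 lf); case: hS.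
Qed.

End Hull.

Lemma hull_image (M N : lmodType CC) (f : M -> N) (P : M -> Prop) (Q : N -> Prop) x :
  linearf f -> (forall x, P x -> hull Q (f x)) -> hull P x -> hull Q (f x).
Proof.
move=> lf h; apply: (@hull_min _ _ (fun x => hull Q (f x))) => //.
exact: (subspace_preim lf (hull_subspace Q)).
Qed.

Section FinDim.
Variable M : lmodType CC.
Implicit Types (P Q S : M -> Prop) (x y : M) (s : seq M).

Lemma in_span_subspace s : subspace (in_span s).
Proof.
split=> [|a x y [c ->] [c' ->]].
  by exists (fun=> 0); rewrite big1 // => i _; rewrite scale0r.
exists (fun i => a * c i + c' i).
rewrite scaler_sumr -big_split /=; apply: eq_bigr => i _.
by rewrite scalerDl scalerA.
Qed.

Lemma in_span_mem s x : x \in s -> in_span s x.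
Proof.
move=> xs; exists (fun i => (i == index x s)%:R).
have lt : (index x s < size s)%N by rewrite index_mem.
rewrite (bigD1 (Ordinal lt)) //= eqxx scale1r nth_index // big1 ?addr0 //.
move=> i /negPf ne; rewrite -(inj_eq val_inj) /= in ne.
by rewrite ne scale0r.
Qed.

Lemma in_span_hull s x : in_span s x <-> hull (fun y => y \in s) x.
Proof.
split=> [[c ->]|]; last first.
  by apply: hull_min; [apply: in_span_subspace | apply: in_span_mem].
apply: subspace_sum => [|i _]; first exact: hull_subspace.
apply: subspaceZ; first exact: hull_subspace.
by apply: hull_gen; apply: mem_nth.
Qed.

Lemma in_span_min s S x : subspace S -> (forall y, y \in s -> S y) ->
  in_span s x -> S x.
Proof. by move=> hS h /in_span_hull; apply: hull_min. Qed.

Lemma fin_dim_sub P Q : (forall x, P x -> Q x) -> fin_dim Q -> fin_dim P.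
Proof. by move=> h [s hs]; exists s => x /h; apply: hs. Qed.

Lemma fin_dim_hull P : fin_dim P -> fin_dim (hull P).
Proof.
move=> [s hs]; exists s => x; apply: hull_min => //.
exact: in_span_subspace.
Qed.

Lemma fin_dim_zero : fin_dim (fun x : M => x = 0).
Proof. by exists [::] => x ->; apply: subspace0; apply: in_span_subspace. Qed.

Lemma fin_dim_or P Q : fin_dim P -> fin_dim Q -> fin_dim (fun x => P x \/ Q x).
Proof.
move=> [s hs] [t ht]; exists (s ++ t) => x [/hs|/ht] /in_span_hull h;
  by apply/in_span_hull; apply: hull_mono h => y; rewrite mem_cat => ->;
     rewrite ?orbT.
Qed.

Lemma fin_dim_bigor (I : eqType) (r : seq I) (P : I -> M -> Prop) :
  (forall i, i \in r -> fin_dim (P i)) ->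
  fin_dim (fun x => exists2 i, i \in r & P i x).
Proof.
elim: r => [|i r IH] h; first by exists [::] => x [].
have h1 : fin_dim (P i) by apply: h; rewrite mem_head.
have /IH h2 : forall j, j \in r -> fin_dim (P j).
  by move=> j jr; apply: h; rewrite in_cons jr orbT.
apply: fin_dim_sub (fin_dim_or h1 h2) => x [j].
rewrite in_cons => /orP[/eqP ->|jr] Px; [by left | by right; exists j].
Qed.

End FinDim.

Lemma fin_dim_bilin (V M N : lmodType CC) (f : V -> M -> N) P Q :
  (forall a u u' w, f (a *: u + u') w = a *: f u w + f u' w) ->
  (forall u, linearf (f u)) ->
  fin_dim P -> fin_dim Q ->
  fin_dim (fun y => exists u w, [/\ P u, Q w & y = f u w]).
Proof.
move=> l1 l2 [s hs] [t ht].
exists [seq f a b | a <- s, b <- t] => y [u [w [/hs hu /ht hw ->]]].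
have l1' w' : linearf (fun u => f u w') by move=> a u1 u2; apply: l1.
apply: (@in_span_min _ s (fun u => in_span _ (f u w)) u) => //.
  by apply: (subspace_preim (l1' w)); apply: in_span_subspace.
move=> a sa.
apply: (@in_span_min _ t (fun w => in_span _ (f a w)) w) => //.
  by apply: (subspace_preim (l2 a)); apply: in_span_subspace.
move=> b tb; apply: in_span_mem; exact: allpairs_f.
Qed.

Section Dsum.
Variable M : lmodType CC.

Lemma big_supp (I : eqType) (s s' : seq I) (f : I -> M) :
  uniq s -> uniq s' -> {subset s <= s'} ->
  (forall i, i \notin s -> f i = 0) ->
  \sum_(i <- s) f i = \sum_(i <- s') f i.
Proof.
move=> us us' sub f0.
rewrite [RHS](bigID (fun i => i \in s)) /= [X in _ + X]big1 => [|i]; last exact: f0.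
rewrite addr0 -[RHS]big_filter; apply: perm_big; apply: uniq_perm => //.
  exact: filter_uniq.
move=> i; rewrite mem_filter; case: (boolP (i \in s)) => // /sub ->.
by [].
Qed.

(** Terms are collected by index and [f] vanishes off [s], so that the list can later be enlarged to
    contain a prescribed index. *)
Lemma hull_dsum (I : eqType) (W : I -> M -> Prop) x :
  (forall i, subspace (W i)) ->
  hull (fun y => exists i, W i y) x ->
  exists (s : seq I) (f : I -> M),
    [/\ uniq s, forall i, W i (f i), forall i, i \notin s -> f i = 0
      & x = \sum_(i <- s) f i].
Proof.
move=> hW; apply: (@hull_min _ _ (fun x => exists s f, [/\ uniq s, forall i, W i (f i),
    forall i, i \notin s -> f i = 0 & x = \sum_(i <- s) f i])) => [|y [i Wy]]; last first.
  exists [:: i], (fun j => if j == i then y else 0); split=> //.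
  - by move=> j; case: eqP => [->|_] //; apply: subspace0.
  - by move=> j; rewrite inE => /negPf ->.
  - by rewrite big_seq1 eqxx.
split=> [|a x1 x2 [s [f [us Wf f0 ->]]] [t [h [ut Wh h0 ->]]]].
  exists [::], (fun=> 0); split=> //; last by rewrite big_nil.
  by move=> i; apply: subspace0.
exists (undup (s ++ t)), (fun i => a *: f i + h i); split.
- exact: undup_uniq.
- move=> i; case: (hW i) => _; exact.
- move=> i; rewrite mem_undup mem_cat negb_or => /andP[/f0 -> /h0 ->].
  by rewrite scaler0 addr0.
- rewrite big_split /= -scaler_sumr; congr (_ *: _ + _);
    apply: big_supp => //; rewrite ?undup_uniq // => i;
    by rewrite mem_undup mem_cat => ->; rewrite ?orbT.
Qed.

End Dsum.

Lemma NoDup_uniq (I : eqType) (s : seq I) : List.NoDup s <-> uniq s.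
Proof.
elim: s => [|x s IH]; first by split=> // _; constructor.
have inP : forall t : seq I, List.In x t <-> x \in t.
  elim=> [|y t IHt] //=; rewrite inE IHt; split.
    by case=> [->|->]; rewrite ?eqxx ?orbT.
  by case/orP=> [/eqP ->|]; [left | right].
split=> /=.
  by move=> h; inversion_clear h; apply/andP; split; [apply/negP => /inP | apply/IH].
by case/andP=> /negP h /IH h'; constructor=> // /inP.
Qed.

Lemma In_mem (I : eqType) (s : seq I) x : List.In x s <-> x \in s.
Proof.
elim: s => [|y s IH] //=; rewrite inE IH; split.
  by case=> [->|->]; rewrite ?eqxx ?orbT.
by case/orP=> [/eqP ->|]; [left | right].
Qed.

Lemma is_dsum_intro (M : lmodType CC) (I : eqType) (W : I -> M -> Prop) (S : M -> Prop) :
  (forall i, subspace (W i)) ->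
  (forall i x, W i x -> S x) ->
  (forall x, S x -> hull (fun y => exists i, W i y) x) ->
  (forall (s : seq I) (f : I -> M), uniq s -> (forall i, W i (f i)) ->
     \sum_(i <- s) f i = 0 -> forall i, i \in s -> f i = 0) ->
  is_dsum W S.
Proof.
move=> hW h1 h2 h3; split=> //; split=> [x /h2 /(hull_dsum hW)|].
  by case=> s [f [_ Wf _ ->]]; exists s, f.
move=> s f /NoDup_uniq us Wf s0 i /In_mem; exact: h3.
Qed.

Lemma is_dsum_hull (M : lmodType CC) (I : Type) (W : I -> M -> Prop) (S : M -> Prop) x :
  is_dsum W S -> S x -> hull (fun y => exists i, W i y) x.
Proof.
move=> [_ [h _]] /h [s [f [Wf ->]]].
apply: subspace_sum => [|i _]; first exact: hull_subspace.
by apply: hull_gen; exists i.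
Qed.

(** * Generalized eigenvectors of a linear operator *)

Section Operator.
Variables (M : lmodType CC) (L : M -> M).
Hypothesis lL : linearf L.

Definition stable (U : M -> Prop) := forall x, U x -> U (L x).

Definition sft (r : CC) (x : M) : M := L x - r *: x.

Lemma sft_lin r : linearf (sft r).
Proof.
move=> a x y; rewrite /sft lL scalerDr scalerBr !scalerA [r * a]mulrC.
by rewrite opprD addrACA.
Qed.

Lemma sft_comm r s x : sft r (sft s x) = sft s (sft r x).
Proof.
rewrite /sft !(linfB lL) !(linfZ lL) !scalerBr !scalerA [s * r]mulrC.
by rewrite !opprD !opprK addrACA.
Qed.

Lemma iter_lin (f : M -> M) n : linearf f -> linearf (iter n f).
Proof. by move=> lf; elim: n => [|n IH] a x y //=; rewrite IH lf. Qed.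

Lemma sftB r s x : sft r x - sft s x = (s - r) *: x.
Proof.
by rewrite /sft opprB [s *: x - _]addrC addrACA subrr add0r scalerBl addrC.
Qed.

Definition geneig (r : CC) (x : M) := exists n, iter n (sft r) x = 0.

Lemma geneig_subspace r : subspace (geneig r).
Proof.
split=> [|a x y [n xn] [m ym]]; first by exists 0%N.
exists (n + m)%N; have lI k := iter_lin k (sft_lin r).
by rewrite (lI _ a) [X in _ + X]iterD ym addnC iterD xn !(linf0 (lI _)) scaler0 addr0.
Qed.

Lemma stable_sft U r x : subspace U -> stable U -> U x -> U (sft r x).
Proof. by move=> hU sU Ux; apply: subspaceB => //; [apply: sU | apply: subspaceZ]. Qed.

Lemma stable_iter_sft U r n x : subspace U -> stable U -> U x -> U (iter n (sft r) x).
Proof. by move=> hU sU Ux; elim: n => [|n IH] //=; apply: stable_sft. Qed.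

(** Since (mu - r) x = [sft r x - sft mu x], membership descends along the iterates. This is the
    Bezout identity for X - r and a power of X - mu, evaluated at [L]. *)
Lemma sft_inv_mem U r mu n x : subspace U -> stable U -> mu != r ->
  U (sft r x) -> U (iter n (sft mu) x) -> U x.
Proof.
move=> hU sU ne; elim: n x => [|n IH] x //= h1; rewrite -iterS iterSr => h2.
have h3 : U (sft mu x).
  by apply: IH => //; rewrite sft_comm; apply: stable_sft.
have e : x = (mu - r)^-1 *: (sft r x - sft mu x).
  by rewrite sftB scalerA mulVf ?scale1r // subr_eq0.
by rewrite e; apply: subspaceZ => //; apply: subspaceB.
Qed.

Lemma sft_iter_inv_mem U r mu n m x : subspace U -> stable U -> mu != r ->
  U (iter m (sft r) x) -> U (iter n (sft mu) x) -> U x.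
Proof.
move=> hU sU ne; elim: m x => [|m IH] x //; rewrite iterSr => h1 h2.
apply: (sft_inv_mem (r := r) (mu := mu) (n := n)) => //.
apply: IH => //.
have -> : iter n (sft mu) (sft r x) = sft r (iter n (sft mu) x).
  by elim: n {h2} => [|n IHn] //=; rewrite IHn sft_comm.
exact: stable_sft.
Qed.

(* With [U = 0] this is the independence of generalized eigenspaces. *)
Lemma geneig_components U (I : eqType) (s : seq I) (lam : I -> CC) (f : I -> M) :
  subspace U -> stable U -> uniq s ->
  {in s &, injective lam} ->
  (forall i, i \in s -> geneig (lam i) (f i)) ->
  U (\sum_(i <- s) f i) -> forall i, i \in s -> U (f i).
Proof.
move=> hU sU; elim: s f => [|j s IH] f //= /andP[js us] inj ge.
rewrite big_cons => Usum.
have [n fn] := ge j (mem_head _ _).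
have lI := iter_lin n (sft_lin (lam j)).
have h i : i \in s -> U (f i).
  move=> iS.
  have [m fm] : geneig (lam i) (f i) by apply: ge; rewrite inE iS orbT.
  have ne : lam i != lam j.
    apply/eqP => e; move: js; rewrite -(inj i j) ?iS //; rewrite inE ?iS ?eqxx ?orbT //.
  have U0 : U 0 by apply: subspace0.
  apply: (sft_iter_inv_mem (r := lam j) (m := n) (n := m) hU sU ne); last by rewrite fm.
  pose f' i := iter n (sft (lam j)) (f i).
  apply: (IH f') => //.
  - by move=> a b sa sb; apply: inj; rewrite inE ?sa ?sb orbT.
  - move=> a sa; have [q fq] : geneig (lam a) (f a) by apply: ge; rewrite inE sa orbT.
    exists q; rewrite /f'.
    have -> : forall z, iter q (sft (lam a)) (iter n (sft (lam j)) z) =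
        iter n (sft (lam j)) (iter q (sft (lam a)) z).
      move=> z; elim: q {fq} => [|q IHq] //=; rewrite IHq.
      by elim: n {IHq f' lI fn} (iter q _ _) => [|n IHn] y //=; rewrite -IHn sft_comm.
    by rewrite fq (linf0 lI).
  - have := stable_iter_sft (lam j) n hU sU Usum.
    by rewrite (linfD lI) fn add0r (linf_sum lI).
move=> i; rewrite inE => /orP[/eqP ->|/h //].
rewrite -[f j](addrK (\sum_(i <- s) f i)); apply: subspaceB => //.
exact: subspace_sum_seq.
Qed.

(** [L - r] is invertible on generalized eigenvectors for any other eigenvalue. *)
Lemma sft_solve r mu n y U : subspace U -> stable U -> mu != r ->
  U y -> iter n (sft mu) y = 0 ->
  exists z, [/\ U z, iter n (sft mu) z = 0 & sft r z = y].
Proof.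
move=> hU sU ne; elim: n y => [|n IH] y Uy /=; rewrite -?iterS ?iterSr.
  by move=> ->; exists 0; split=> //; [apply: subspace0 | apply: (linf0 (sft_lin r))].
move=> yn; have [z [Uz zn ez]] := IH _ (stable_sft mu hU sU Uy) yn.
have lI k := iter_lin k (sft_lin mu).
exists ((mu - r)^-1 *: (y - z)); split.
- by apply: subspaceZ => //; apply: subspaceB.
- rewrite -iterS (linfZ (lI _)) (linfB (lI _)) iterSr yn iterS zn.
  by rewrite (linf0 (sft_lin mu)) subr0 scaler0.
- rewrite (linfZ (sft_lin r)) (linfB (sft_lin r)) ez sftB.
  by rewrite scalerA mulVf ?scale1r // subr_eq0.
Qed.

(** Primary decomposition of one vector. By induction [sft r x] decomposes; its components at
    eigenvalues other than [r] have preimages under [sft r], and subtracting these from [x] leaves a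
    generalized eigenvector for [r]. *)
Lemma prod_geneig (rs : seq CC) x U : subspace U -> stable U -> U x ->
  foldr sft x rs = 0 -> hull (fun y => U y /\ exists r, geneig r y) x.
Proof.
move=> hU sU; elim/last_ind: rs x => [|rs r IH] x Ux /=.
  by move=> ->; apply: subspace0; apply: hull_subspace.
rewrite foldr_rcons => h0.
have := IH _ (stable_sft r hU sU Ux) h0.
have : exists y0, sft r x = y0 by exists (sft r x).
case=> y0 ey; rewrite ey.
move=> hy.
have [z [zg [Uz e]]] : exists z, hull (fun y => U y /\ exists r, geneig r y) z /\
    U z /\ geneig r (y0 - sft r z).
  pose Q y := exists z, hull (fun y => U y /\ exists r, geneig r y) z /\ U z /\
      geneig r (y - sft r z).
  apply: (@hull_min _ _ Q) hy => {y0 ey}.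
    split=> [|a y1 y2 [z1 [h1 [U1 g1]]] [z2 [h2 [U2 g2]]]].
      exists 0; split; first by apply: subspace0; apply: hull_subspace.
      split; first exact: subspace0.
      by rewrite (linf0 (sft_lin r)) subr0; apply: subspace0; apply: geneig_subspace.
    exists (a *: z1 + z2); split; first by 
      case: (hull_subspace (fun y => U y /\ exists r, geneig r y)) => _; apply.
    split; first by case: hU => _; apply.
    rewrite (sft_lin r).
    have -> : a *: y1 + y2 - (a *: sft r z1 + sft r z2) = a *:
        (y1 - sft r z1) + (y2 - sft r z2).
      by rewrite opprD [LHS]addrACA -scalerBr.
    by case: (geneig_subspace r) => _; apply.
  move=> y [Uy [mu [n gn]]].
  case: (eqVneq mu r) => [e|ne].
    exists 0; split; first by apply: subspace0; apply: hull_subspace.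
    split; first exact: subspace0.
    by rewrite (linf0 (sft_lin r)) subr0 -e; exists n.
  have [z [Uz zn ez]] := sft_solve hU sU ne Uy gn.
  exists z; split; first by apply: hull_gen; split=> //; exists mu, n.
  by split=> //; rewrite ez subrr; apply: subspace0; apply: geneig_subspace.
rewrite -[x](subrK z); apply: subspaceD => //; first exact: hull_subspace.
apply: hull_gen; split; first exact: subspaceB.
exists r; move: e; rewrite -ey -(linfB (sft_lin r)) => -[n en].
by exists n.+1; rewrite iterSr.
Qed.

(** The last nonzero vector in the chain of shifts is an eigenvector. *)
Lemma prod_eig (rs : seq CC) x U : subspace U -> stable U -> U x -> x <> 0 ->
  foldr sft x rs = 0 -> exists y r, [/\ U y, y <> 0 & L y = r *: y].
Proof.
move=> hU sU; elim/last_ind: rs x => [|rs r IH] x Ux nx //=.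
rewrite foldr_rcons => h0.
case: (pselect (sft r x = 0)) => [/eqP|ne].
  by rewrite subr_eq0 => /eqP e; exists x, r.
exact: (IH _ (stable_sft r hU sU Ux)).
Qed.

Definition pact (p : {poly CC}) (x : M) := \sum_(i < size p) p`_i *: iter i L x.

Lemma pactE n (p : {poly CC}) x : (size p <= n)%N ->
  pact p x = \sum_(i < n) p`_i *: iter i L x.
Proof.
move=> le; rewrite /pact (big_ord_widen n (fun i => p`_i *: iter i L x)) //.
rewrite big_mkcond /=; apply: eq_bigr => i _.
by case: ltnP => // /(nth_default 0) ->; rewrite scale0r.
Qed.

Lemma pact_sub p q x : pact (p - q) x = pact p x - pact q x.
Proof.
pose n := maxn (size p) (size q).
rewrite (@pactE n p) ?leq_maxl // (@pactE n q) ?leq_maxr //.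
rewrite (@pactE n (p - q)); last by rewrite (leq_trans (size_polyD _ _)) // size_polyN.
by rewrite -sumrB; apply: eq_bigr => i _; rewrite coefB scalerBl.
Qed.

Lemma pactZ c p x : pact (c *: p) x = c *: pact p x.
Proof.
rewrite (@pactE (size p)) ?size_scale_leq // /pact scaler_sumr.
by apply: eq_bigr => i _; rewrite coefZ scalerA.
Qed.

Lemma pactX p x : pact (p * 'X) x = pact p (L x).
Proof.
rewrite (@pactE (size p).+1); last first.
  by rewrite (leq_trans (size_polyMleq _ _)) // size_polyX addn2.
rewrite big_ord_recl coefMX eqxx scale0r add0r.
by apply: eq_bigr => i _; rewrite coefMX /= -iterSr.
Qed.

Lemma pact_lin p : linearf (pact p).
Proof.
move=> a x y; rewrite /pact scaler_sumr -big_split /=; apply: eq_bigr => i _.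
by rewrite (iter_lin i lL) scalerDr !scalerA [a * _]mulrC.
Qed.

Lemma pact_prod (rs : seq CC) x : pact (\prod_(z <- rs) ('X - z%:P)) x = foldr sft x rs.
Proof.
elim: rs x => [|r rs IH] x.
  by rewrite big_nil /pact size_poly1 big_ord_recl big_ord0 addr0 coef1 scale1r.
rewrite big_cons mulrC mulrBr pact_sub pactX [_ * r%:P]mulrC mul_polyC pactZ.
rewrite -(linfZ (pact_lin _)) -(linfB (pact_lin _)) /= IH.
rewrite -/(sft r x).
by elim: rs {IH} => [|q rs IH] //=; rewrite IH sft_comm.
Qed.

(** The n+1 vectors [iter i L x] lie in the span of n vectors. A row in the left kernel of their
    coefficient matrix is a nonzero polynomial [p] with p(L)x = 0, and [p] splits over the complex
    numbers. *)
Lemma fin_dim_annihilator U x : stable U -> fin_dim U -> U x ->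
  exists rs, foldr sft x rs = 0.
Proof.
move=> sU [s hs] Ux; pose n := size s.
have Uit i : U (iter i L x) by elim: i => [|i IH] //=; apply: sU.
have [A hA] : exists A : 'I_n.+1 -> nat -> CC, forall i : 'I_n.+1, iter i L x =
    \sum_(j < n) A i j *: s`_j.
  have h (i : 'I_n.+1) : {c : nat -> CC | iter i L x = \sum_(j < n) c j *: s`_j}.
    by apply: cid; apply: hs.
  by exists (fun i => sval (h i)) => i; case: (h i).
pose B := \matrix_(i < n.+1, j < n) A i j.
have nz : kermx B != 0.
  rewrite -mxrank_eq0 mxrank_ker subn_eq0 -ltnNge ltnS; exact: rank_leq_col.
pose c := nz_row (kermx B).
have nc : c != 0 by rewrite nz_row_eq0.
have cB : c *m B = 0 by apply/sub_kermxP; exact: nz_row_sub.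
pose p := \poly_(i < n.+1) (c ord0 (inord i)).
have np : p != 0.
  apply: contraNneq nc => p0; apply/eqP/rowP => i; rewrite mxE.
  by have := congr1 (fun q : {poly CC} => q`_i) p0;
      rewrite coef_poly ltn_ord inord_val coef0.
have px : pact p x = 0.
  rewrite (@pactE n.+1) ?size_poly //.
  transitivity (\sum_(j < n) (\sum_(i < n.+1) c ord0 i * A i j) *: s`_j).
    under eq_bigr => i _ do rewrite coef_poly ltn_ord inord_val hA scaler_sumr.
    rewrite exchange_big; apply: eq_bigr => j _; rewrite scaler_suml.
    by apply: eq_bigr => i _; rewrite scalerA.
  rewrite big1 // => j _.
  have := congr1 (fun q : 'rV_n => q ord0 j) cB; rewrite !mxE.
  under eq_bigr => i _ do rewrite mxE.
  by move=> ->; rewrite scale0r.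
have [rs e] := closed_field_poly_normal p.
exists rs; move: px; rewrite e pactZ pact_prod => /eqP.
by rewrite scaler_eq0 lead_coef_eq0 (negPf np) => /eqP.
Qed.

End Operator.

(** * The root of unity [zeta T] and eigenvectors of automorphisms of finite order *)

Section Zeta.
Variable T : nat.
Hypothesis T0 : (0 < T)%N.

Lemma zetaX n : zeta T ^+ n =
  Complex (cos (2 * pi / T%:R *+ n)) (sin (2 * pi / T%:R *+ n)).
Proof.
rewrite /zeta; move: (2 * pi / _) => t.
elim: n => [|n IH]; first by rewrite mulr0n cos0 sin0 expr0.
rewrite exprSr IH mulrSr trigo.cosD trigo.sinD.
apply/eqP; rewrite eq_complex /=; apply/andP; split; apply/eqP => //.
by rewrite addrC.
Qed.

Lemma zetaT : zeta T ^+ T = 1.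
Proof.
rewrite zetaX -[_ *+ T]mulr_natr mulfVK; last by rewrite pnatr_eq0 -lt0n.
by rewrite mulr_natl cos2pi sin2pi.
Qed.

Lemma zeta_neq0 : zeta T != 0.
Proof.
apply: contraTneq (oner_neq0 CC) => z0.
by rewrite -zetaT z0 expr0n eqn0Ngt T0 /= eqxx.
Qed.

(** With t = pi n / T, the value 1 would give cos 2t = 1, hence sin t = 0, although 0 < t < pi. *)
Lemma zeta_prim n : (0 < n < T)%N -> zeta T ^+ n != 1.
Proof.
move=> /andP[n0 nT]; rewrite zetaX; apply/negP => /eqP [+ _].
pose t : Rdefinitions.R := pi * n%:R / T%:R.
have -> : 2 * pi / T%:R *+ n = t *+ 2 :> Rdefinitions.R.
  by rewrite /t -[LHS]mulr_natr -[RHS]mulr_natr; ring.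
rewrite cos_mulr2n => e.
have Tp : 0 < T%:R :> Rdefinitions.R by rewrite ltr0n.
have t0 : 0 < t by rewrite divr_gt0 // mulr_gt0 ?pi_gt0 ?ltr0n.
have tp : t < pi by rewrite ltr_pdivrMr // ltr_pM2l ?pi_gt0 // ltr_nat.
have sp : 0 < sin t by apply: sin_gt0_pi; rewrite ?t0.
have := cos2Dsin2 t => e2.
have : 0 < sin t ^+ 2 by rewrite exprn_gt0.
rewrite -(addrK (sin t ^+ 2) (cos t ^+ 2)) e2 in e.
nra.
Qed.

Lemma zeta_sum (j : nat) : (0 < j < T)%N -> \sum_(r < T) zeta T ^+ (r * j) = 0.
Proof.
move=> hj.
have h : zeta T ^+ j != 1 by apply: zeta_prim.
have : (1 - zeta T ^+ j) * \sum_(r < T) (zeta T ^+ j) ^+ r = 0.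
  rewrite -opprB mulNr -subrX1.
  by rewrite -exprM mulnC exprM zetaT expr1n subrr oppr0.
move/eqP; rewrite mulf_eq0 subr_eq0 eq_sym (negPf h) /= => /eqP e.
rewrite -[RHS]e; apply: eq_bigr => r _.
by rewrite -exprM mulnC.
Qed.

Lemma zeta_dvd (k : int) : (zeta T ^ k == 1) = (T %| k)%Z.
Proof.
have zu : zeta T \is a GRing.unit by rewrite unitfE zeta_neq0.
have -> : zeta T ^ k = zeta T ^ (k %% T)%Z.
  rewrite {1}(divz_eq k T) (exprzDr zu).
  by rewrite [_ * T%:Z]mulrC -exprz_exp -exprnP zetaT exp1rz mul1r.
have T0z : (T%:Z != 0) by rewrite eqz_nat -lt0n.
have := modz_ge0 k T0z.
have : (k %% T)%Z < T by rewrite ltz_mod.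
rewrite (_ : (T %| k)%Z = ((k %% T)%Z == 0)); last exact/dvdz_mod0P/eqP.
case: (k %% T)%Z => // m; rewrite ltz_nat => lt _.
rewrite -exprnP; case: m lt => [|m] lt; first by rewrite expr0 !eqxx.
by apply/negbTE/zeta_prim.
Qed.

Lemma zeta_expz_eq (k l : int) : (T %| k - l)%Z -> zeta T ^ k = zeta T ^ l.
Proof.
have zu : zeta T \is a GRing.unit by rewrite unitfE zeta_neq0.
rewrite -zeta_dvd => /eqP h.
by rewrite -[k](subrK l) (exprzDr zu) h mul1r.
Qed.

Section Dec.
Variables (V : lmodType CC) (g : V -> V).
Hypothesis lg : linearf g.
Hypothesis gT : forall v, iter T g v = v.

Lemma eigsp_subspace r : subspace (eigsp g T r).
Proof.
rewrite /eigsp; split=> [|a x y hx hy]; first by rewrite (linf0 lg) scaler0.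
by rewrite lg hx hy scalerDr !scalerA mulrC.
Qed.

Lemma eigsp_cong r s v : (T %| r - s)%Z -> eigsp g T r v -> eigsp g T s v.
Proof.
rewrite /eigsp => h ->; rewrite (@zeta_expz_eq (- r) (- s)) //.
by rewrite opprK addrC -opprB dvdzE abszN -dvdzE.
Qed.

(** Discrete Fourier transform over the cyclic group generated by [g]: [p r] projects to the
    eigenvalue [zeta T ^ (- r)], and the projections add up to [v] by [zeta_sum]. *)
Lemma eigen_hull (U : V -> Prop) v : subspace U -> (forall x, U x -> U (g x)) ->
  U v -> hull (fun y => U y /\ exists r : int, eigsp g T r y) v.
Proof.
move=> hU gU Uv.
pose p (r : nat) := T%:R^-1 *: \sum_(j < T) zeta T ^+ (r * j) *: iter j g v.
have Tn : (T%:R : CC) != 0 by rewrite pnatr_eq0 -lt0n.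
have -> : v = \sum_(r < T) p r.
  rewrite /p -scaler_sumr exchange_big /=.
  rewrite (bigD1 (Ordinal T0)) //= [X in _ + X]big1 => [|j nj].
    under eq_bigr => r _ do rewrite muln0 expr0 scale1r.
    by rewrite sumr_const card_ord addr0 -[v *+ T]scaler_nat scalerA mulVf // scale1r.
  rewrite -scaler_suml zeta_sum ?scale0r // ltn_ord andbT lt0n.
  by apply: contraNneq nj => j0; apply/eqP/val_inj.
apply: subspace_sum => [|r _]; first exact: hull_subspace.
apply: hull_gen; split.
  apply: subspaceZ => //; apply: subspace_sum => // j _; apply: subspaceZ => //.
  by elim: (j : nat) => [|i IH] //=; apply: gU.
exists (r : nat)%:Z; rewrite /eigsp /p (linfZ lg) scalerA mulrC -scalerA.
congr (_ *: _); rewrite (linf_sum lg) scaler_sumr.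
pose F j := zeta T ^+ (r * j) *: iter j g v.
have FT : F T = F 0%N.
  by rewrite /F gT muln0 mulnC exprM zetaT expr1n expr0.
have e : \sum_(j < T) F j.+1 = \sum_(j < T) F j.
  apply: (addrI (F 0%N)); rewrite -(big_ord_recl T (fun j : 'I_T.+1 => F j)).
  by rewrite big_ord_recr /= FT addrC.
rewrite -[RHS]scaler_sumr -e scaler_sumr; apply: eq_bigr => j _.
rewrite (linfZ lg) /F scalerA -iterS mulnS exprD mulrA -invr_expz -exprnP.
by rewrite mulVf ?mul1r // expf_neq0 // zeta_neq0.
Qed.

End Dec.
End Zeta.

(** * Weights of modes and the subspaces C_n(V) *)

Section Binomial.

Lemma binC0 a : binC a 0 = 1.
Proof. by rewrite /binC big_ord0 fact0 divr1. Qed.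

Lemma binC1 a : binC a 1 = a.
Proof. by rewrite /binC big_ord1 subr0 divr1. Qed.

Lemma binC_nat0 (n i : nat) : (n < i)%N -> binC n%:R i = 0.
Proof.
move=> h; rewrite /binC (bigD1 (Ordinal h)) //= subrr mul0r mul0r //.
Qed.

(** In the expansion of u(-1)v all coefficients are therefore 1. *)
Lemma binCN1 i : (-1) ^+ i * binC (-1) i = 1.
Proof.
rewrite /binC mulrA.
suff -> : (-1) ^+ i * \prod_(j < i) (-1 - j%:R) = (i`!)%:R :> CC.
  by rewrite divff // pnatr_eq0 -lt0n fact_gt0.
elim: i => [|i IH]; first by rewrite big_ord0 expr0 mulr1.
rewrite big_ord_recr /= exprSr mulrACA IH factS natrM mulrC; congr (_ * _).
by rewrite mulN1r opprB opprK -natr1.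
Qed.

End Binomial.

Section VOSA.
Variables (V : lmodType CC) (Y : V -> int -> V -> V) (vac om : V).
Hypothesis HV : is_VOSA Y vac om.

Lemma Y_linl n w : linearf (fun u => Y u n w).
Proof. by case: HV => h _ a u v; apply: h. Qed.

Lemma Y_linr u n : linearf (Y u n).
Proof. by case: HV => _ [h _]. Qed.

Lemma Y_create u : Y u (-1) vac = u.
Proof. by case: HV => _ [_ [_ [_ [h _]]]]. Qed.

Lemma Y_vac0 u n : 0 <= n -> Y u n vac = 0.
Proof. by case: HV => _ [_ [_ [_ [_ [h _]]]]]; apply: h. Qed.

Lemma Y_der u n v : Y (Y om 0 u) n v = - (n%:~R) *: Y u (n - 1) v.
Proof. by case: HV => _ [_ [_ [_ [_ [_ [_ [h _]]]]]]]; apply: h. Qed.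

Lemma Y_jacobi u v b1 b2 : parity Y om u b1 -> parity Y om v b2 ->
  forall (p q r : int) w, exists N : nat, forall B : nat, (N <= B)%N ->
    \sum_(i < B) binC p%:~R i *: Y (Y u (r + i%:Z) v) (p + q - i%:Z) w =
    \sum_(i < B) ((-1) ^+ i * binC r%:~R i) *:
          (Y u (p + r - i%:Z) (Y v (q + i%:Z) w)
           - (eps b1 b2 * (-1) ^ r) *: Y v (q + r - i%:Z) (Y u (p + i%:Z) w)).
Proof.
by case: HV => _ [_ [_ [_ [_ [_ [_ [_ [_ [_ [_ h]]]]]]]]]] pu pv p q r w; apply: h.
Qed.

Lemma wspace_dsum : is_dsum (wspace Y om) (fun _ => True).
Proof. by case: HV => _ [_ [_ [_ [_ [_ [_ [_ [h _]]]]]]]]. Qed.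

Lemma wspace_fin d : fin_dim (wspace Y om d).
Proof. by case: HV => _ [_ [_ [_ [_ [_ [_ [_ [_ [h _]]]]]]]]]. Qed.

Lemma wspace_low : exists d0 : int, forall d v, d < d0 -> homw Y om v d -> v = 0.
Proof. by case: HV => _ [_ [_ [_ [_ [_ [_ [_ [_ [_ [h _]]]]]]]]]]. Qed.

Local Notation hom := (homw Y om).

Lemma homE v d : hom v d <-> Y om 1 v = (d%:~R / 2%:R) *: v.
Proof. by []. Qed.

Lemma hom_subspace d : subspace (wspace Y om d).
Proof.
rewrite /wspace; split=> [|a x y /homE hx /homE hy]; apply/homE.
  by rewrite (linf0 (Y_linr _ _)) scaler0.
by rewrite Y_linr hx hy scalerDr !scalerA mulrC.
Qed.

Lemma hom0 d : hom 0 d.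
Proof. exact: subspace0 (hom_subspace d). Qed.

Lemma hom_parity v d : hom v d -> parity Y om v (~~ (2 %| d)%Z).
Proof.
by move=> h; exists [:: d], (fun=> v); split=> [e|]; rewrite ?inE ?big_seq1 // => /eqP ->.
Qed.

Lemma vac_hom : hom vac 0.
Proof. by apply/homE; rewrite Y_vac0 // mul0r scale0r. Qed.

(** As omega = L(-2)1, this is [L(0), L(-2)]1 = 2 L(-2)1; the central term is absent because 0 - 2
    is not 0. *)
Lemma om_hom : hom om 4.
Proof.
case: HV => _ [_ [_ [_ [_ [_ [[c hc] _]]]]]].
have := hc 0 (-2) vac; rewrite /Lop.
have -> : (-2 + 1 : int) = -1 by [].
have -> : (0 + 1 : int) = 1 by [].
rewrite !Y_create Y_vac0 // (linf0 (Y_linr _ _)) subr0 => h; apply/homE; rewrite h.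
have -> : (0 - 2 == 0 :> int) = false by [].
rewrite scale0r addr0; congr (_ *: _).
have -> : (0 - - 2 : int) = 2 by [].
by rewrite -[4%:~R]/(4%:R) -[2%:~R]/(2%:R); field.
Qed.

Lemma commutator_formula u v a b (p q : int) w : hom u a -> hom v b ->
  exists N : nat, forall B : nat, (N <= B)%N ->
    \sum_(i < B) binC p%:~R i *: Y (Y u i%:Z v) (p + q - i%:Z) w =
    Y u p (Y v q w) - eps (~~ (2 %| a)%Z) (~~ (2 %| b)%Z) *: Y v q (Y u p w).
Proof.
move=> /hom_parity pu /hom_parity pv.
have [N hN] := Y_jacobi pu pv p q 0 w.
(* One more than [N], so that the right-hand sum contains i = 0, its only index with a nonzero
   binomial. *)
exists N.+1 => B lt.
have := hN B (ltnW lt); under eq_bigr => i _ do rewrite add0r.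
move=> ->; case: B lt => // B _; rewrite big_ord_recl big1 => [|i _].
  by rewrite expr0 mul1r binC0 scale1r expr0z mulr1 !subr0 !addr0.
by rewrite (@binC_nat0 0) // mulr0 scale0r.
Qed.

Lemma L0_comm u a n w : hom u a ->
  Y om 1 (Y u n w) - Y u n (Y om 1 w) = (a%:~R / 2%:R - n%:~R - 1) *: Y u n w.
Proof.
move=> hu; have [N hN] := commutator_formula 1 n w om_hom hu.
have := hN N.+2 (leqW (leqW (leqnn N))).
rewrite /eps /= expr0 scale1r => <-.
rewrite !big_ord_recl big1 => [|i _]; last by rewrite (@binC_nat0 1) // scale0r.
rewrite addr0 /= binC0 (binC1 1) !scale1r -[Y om 0%Z u]/(Y om 0 u) Y_der.
have e1 : 1 + n - 1 = n :> int by ring.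
rewrite -[bump 0 0]/1%N !e1 addr0; move/homE: hu => ->.
rewrite (linfZ (Y_linl _ _)) -scalerDl; congr (_ *: _).
by rewrite rmorphD /=; ring.
Qed.

Lemma hom_Y u v a b n : hom u a -> hom v b -> hom (Y u n v) (a + b - 2 * n - 2).
Proof.
move=> hu hv; apply/homE.
have := L0_comm n v hu; move/homE: hv => ->.
rewrite (linfZ (Y_linr _ _)) => /eqP; rewrite subr_eq -scalerDl => /eqP ->.
congr (_ *: _); rewrite !rmorphB !rmorphD rmorphM /=; by field.
Qed.

Lemma hom_hull v : hull (fun y => exists d, hom y d) v.
Proof. exact: (is_dsum_hull wspace_dsum). Qed.

Lemma iterate_formula u v a b (q r : int) w : hom u a -> hom v b ->
  exists N : nat, forall B : nat, (N <= B)%N ->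
    Y (Y u r v) q w =
    \sum_(i < B) ((-1) ^+ i * binC r%:~R i) *:
          (Y u (r - i%:Z) (Y v (q + i%:Z) w)
           - (eps (~~ (2 %| a)%Z) (~~ (2 %| b)%Z) * (-1) ^ r) *:
               Y v (q + r - i%:Z) (Y u i%:Z w)).
Proof.
move=> /hom_parity pu /hom_parity pv.
have [N hN] := Y_jacobi pu pv 0 q r w.
exists N.+1 => B lt.
have := hN B (ltnW lt); case: B lt => // B _; rewrite [LHS]big_ord_recl big1 => [|i _].
  rewrite binC0 scale1r !addr0 add0r => ->.
  by apply: eq_bigr => i _; rewrite !add0r.
by rewrite (@binC_nat0 0) // scale0r.
Qed.

(* The weight-[d/2] part of C_l(V) = span of the u(-l)v; weights are counted in
   half units. *)
Definition Cn (l : nat) (d : int) : V -> Prop :=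
  hull (fun x => exists u v a b,
    [/\ hom u a, hom v b, a + b + 2 * l%:Z - 2 = d & x = Y u (- l%:Z) v]).

Lemma Cn_subspace l d : subspace (Cn l d).
Proof. exact: hull_subspace. Qed.

Lemma Cn_hom l d x : Cn l d x -> hom x d.
Proof.
apply: (hull_min (hom_subspace d)) => y [u [v [a [b [hu hv <- ->]]]]].
by have := hom_Y (- l%:Z) hu hv; rewrite /wspace mulrN opprK.
Qed.

(** u(-l-1) is the mode (L(-1)u)(-l) divided by l. *)
Lemma CnS l d x : (0 < l)%N -> Cn l.+1 d x -> Cn l d x.
Proof.
move=> l0; apply: hull_sub => y [u [v [a [b [hu hv e ->]]]]].
have ln : (l%:R : CC) != 0 by rewrite pnatr_eq0 -lt0n.
have -> : Y u (- l.+1%:Z) v = l%:R^-1 *: Y (Y om 0 u) (- l%:Z) v.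
  rewrite Y_der rmorphN opprK scalerA mulVf // scale1r; congr (Y _ _ _); lia.
apply: subspaceZ; first exact: hull_subspace.
apply: hull_gen; exists (Y om 0 u), v, (4 + a - 2 * 0 - 2), b; split=> //.
  exact: hom_Y om_hom hu.
by rewrite -e; lia.
Qed.

Lemma Cn_le l l' d x : (0 < l)%N -> (l <= l')%N -> Cn l' d x -> Cn l d x.
Proof.
move=> l0 /subnK <-; elim: (l' - l)%N => [|n IH] //.
by rewrite addSn => /CnS h; apply: IH; apply: h; rewrite addn_gt0 l0 orbT.
Qed.

Lemma Cn_mode l u v a b n d : (0 < l)%N -> hom u a -> hom v b -> n <= - l%:Z ->
  a + b - 2 * n - 2 = d -> Cn l d (Y u n v).
Proof.
move=> l0 hu hv hn e; have [m em] : exists m : nat, n = - m%:Z.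
  by exists `|n|%N; lia.
apply: (@Cn_le l m) => //; first lia.
by apply: hull_gen; exists u, v, a, b; split=> //; [lia | rewrite em].
Qed.

(** After commuting, v(n) is outermost. The commutator consists of modes (u(i)v)(m+n-i), and m+n-i
    is at most -l because m is at most 0. *)
Lemma Cn_swap l u v w a b c m n d : (0 < l)%N -> hom u a -> hom v b -> hom w c ->
  m <= 0 -> n <= - l%:Z -> a + b + c - 2 * m - 2 * n - 4 = d ->
  Cn l d (Y u m (Y v n w)).
Proof.
move=> l0 hu hv hw hm hn e.
have [N hN] := commutator_formula m n w hu hv.
have /eqP := hN N (leqnn _); rewrite eq_sym subr_eq => /eqP ->.
apply: subspaceD; first exact: Cn_subspace.
  apply: subspace_sum => [|i _]; first exact: Cn_subspace.
  apply: subspaceZ; first exact: Cn_subspace.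
  apply: Cn_mode l0 (hom_Y _ hu hv) hw _ _; lia.
apply: subspaceZ; first exact: Cn_subspace.
apply: Cn_mode l0 hv (hom_Y _ hu hw) hn _; lia.
Qed.

(* In the expansion of (u(-1)v)(1-2l)w, a vector of C_(2l-1)(V), the term
   u(-l)v(-l)w is the only one with no mode at or below -(l+1). *)
Lemma Cn_square l u v w a b c d : (1 < l)%N -> hom u a -> hom v b -> hom w c ->
  a + b + c + 4 * l%:Z - 4 = d ->
  Cn l.+1 d (Y u (- l%:Z) (Y v (- l%:Z) w)).
Proof.
move=> l1 hu hv hw e; have hS := Cn_subspace l.+1 d.
have [N hN] := iterate_formula (1 - 2 * l%:Z) (-1) w hu hv.
(* The index [l.-1] carries u(-l)v(-l)w; [maxn] guarantees that it occurs in the truncated sum. *)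
have lB : (l.-1 < maxn N l)%N by rewrite leq_max; lia.
have := hN (maxn N l) (leq_maxl _ _).
rewrite (bigD1 (Ordinal lB)) //= binCN1 scale1r => /esym h.
have : Cn l.+1 d (Y (Y u (-1) v) (1 - 2 * l%:Z) w).
  by apply: Cn_mode (hom_Y _ hu hv) hw _ _ => //; lia.
rewrite -h subspaceDr //; last first.
  apply: subspace_sum => // i ni; rewrite binCN1 scale1r.
  have {}ni : (i : nat) <> l.-1 by move=> ei; case/eqP: ni; apply: val_inj.
  apply: subspaceB => //; last first.
    apply: subspaceZ => //; apply: Cn_mode hv (hom_Y _ hu hw) _ _ => //; lia.
  case: (ltnP i l) => il.
    by apply: Cn_swap hu hv hw _ _ _ => //; lia.
  by apply: Cn_mode hu (hom_Y _ hv hw) _ _ => //; lia.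
rewrite -scaleNr subspaceDr //; last first.
  apply: subspaceZ => //; apply: Cn_mode hv (hom_Y _ hu hw) _ _ => //; lia.
by congr (Cn _ _ (Y _ _ (Y _ _ _))); lia.
Qed.

(** The iterate formula has terms u(-l-i)v(-l+i)w and v(-2l-i)u(i)w; only u(-l)v(-l)w has no outer
    mode at or below -(l+1), and [Cn_square] covers it. *)
Lemma Cn_iter l u v w a b c d : (1 < l)%N -> hom u a -> hom v b -> hom w c ->
  a + b + c + 4 * l%:Z - 4 = d ->
  Cn l.+1 d (Y (Y u (- l%:Z) v) (- l%:Z) w).
Proof.
move=> l1 hu hv hw e; have hS := Cn_subspace l.+1 d.
have [N hN] := iterate_formula (- l%:Z) (- l%:Z) w hu hv.
rewrite (hN N) //; apply: subspace_sum => // i _.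
apply: subspaceZ => //; apply: subspaceB => //; last first.
  apply: subspaceZ => //; apply: Cn_mode hv (hom_Y _ hu hw) _ _ => //; lia.
case: (posnP i) => [->|i0].
  by rewrite !addr0; apply: Cn_square hu hv hw _.
by apply: Cn_mode hu (hom_Y _ hv hw) _ _ => //; lia.
Qed.

(** [K] bounds the weights occurring in a finite set spanning V modulo C_2(V). A vector of weight d
    above [K] is compared with its decomposition in weight d, where that set contributes nothing.
    [W] is C_2(V) in weight d and the full weight space elsewhere. *)
Lemma C2_large_weight : C2_cofinite Y -> exists K : int, forall d v, K < d ->
    hom v d -> Cn 2 d v.
Proof.
move=> [s hs].
pose le (K : int) := hull (fun y => exists2 d : int, d <= K & hom y d).
have leS K : subspace (le K) by apply: hull_subspace.
have le_mono K K' x : K <= K' -> le K x -> le K' x.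
  by move=> h; apply: hull_mono => y [d dK hd]; exists d => //; lia.
have le_ex x : exists K, le K x.
  case: wspace_dsum => _ [/(_ x I) [ds [f [hf ->]]] _].
  elim: ds => [|d ds [K IH]]; first by exists 0; rewrite big_nil; apply: subspace0.
  exists (Num.max K d); rewrite big_cons; apply: subspaceD => //.
    by apply: hull_gen; exists d; [rewrite le_max lexx orbT | apply: hf].
  by apply: le_mono IH; rewrite le_max lexx.
have [K hK] : exists K, forall x, x \in s -> le K x.
  elim: s {hs} => [|x s [K IH]]; first by exists 0.
  have [K' h] := le_ex x.
  exists (Num.max K K') => y; rewrite inE => /orP[/eqP ->|ys].
    by apply: le_mono h; rewrite le_max lexx orbT.
  by apply: (le_mono K); [rewrite le_max lexx | apply: IH].
exists K => d v dK hv.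
pose W (e : int) := if e == d then Cn 2 d else wspace Y om e.
have WS e : subspace (W e).
  by rewrite /W; case: ifP => _; [apply: Cn_subspace | apply: hom_subspace].
pose U := hull (fun y => exists e, W e y).
have US : subspace U by apply: hull_subspace.
have Uhom y e : hom y e -> e != d -> U y.
  by move=> h /negPf ne; apply: hull_gen; exists e; rewrite /W ne.
have Uv : U v.
  have [c [ps e]] := hs v; rewrite -[v](subrK (\sum_(i < size s) c i *: s`_i)).
  apply: subspaceD => //; last first.
    apply: subspace_sum => // i _; apply: subspaceZ => //.
    have := hK _ (mem_nth 0 (ltn_ord i)); apply: hull_min => // y [e' le' he].
    by apply: Uhom he _; apply/eqP; lia.
  rewrite e; apply: subspace_sum => // -[u w] _ /=.
  move: (hom_hull u); apply: (@hull_min _ _ (fun u => U (Y u (-2) w))).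
    by apply: (subspace_preim (Y_linl (-2) w) US).
  move=> {}u [a ha]; move: (hom_hull w); apply: (@hull_min _ _ (fun w => U (Y u (-2) w))).
    by apply: (subspace_preim (Y_linr u (-2)) US).
  move=> {}w [b hb].
  case: (eqVneq (a + b + 2) d) => [E|ne].
    apply: hull_gen; exists d; rewrite /W eqxx; apply: hull_gen.
    by exists u, w, a, b; split=> //; lia.
  by apply: (Uhom _ (a + b - 2 * (-2) - 2)); [apply: hom_Y | apply: contraNneq ne; lia].
case: (hull_dsum WS Uv) => es [f [ues Wf f0 ev]].
pose es' := undup (d :: es).
have ues' : uniq es' by apply: undup_uniq.
have des' : d \in es' by rewrite mem_undup mem_head.
rewrite (@big_supp _ _ es es') // in ev; last first.
  by move=> e h; rewrite mem_undup inE h orbT.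
case: wspace_dsum => _ [_ /(_ es' (fun e => if e == d then f e - v else f e))].
move=> /(_ (proj2 (NoDup_uniq _) ues')) h.
have Cfd : Cn 2 d (f d) by have := Wf d; rewrite /W eqxx.
suff -> : v = f d by [].
apply/esym/eqP; rewrite -subr_eq0; apply/eqP.
have := h _ _ d (proj2 (In_mem _ _) des'); rewrite eqxx; apply.
  move=> e; have := Wf e; rewrite /W; case: eqP => [->|//] /Cn_hom hfd.
  exact: (subspaceB (hom_subspace d)).
rewrite (bigD1_seq d) //= eqxx.
under eq_bigr => e /negPf ne do rewrite ne.
by rewrite addrAC -(bigD1_seq d (F := f)) //= -ev subrr.
Qed.

(* In weight large compared with [K], each generator u(-l)w of C_l(V) has u or w
   of weight above [K], hence in C_l(V), and then u(-l)w is in C_(l+1)(V). *)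
Theorem Cn_large_weight l : C2_cofinite Y -> (1 < l)%N ->
  exists K : int, forall d v, K < d -> hom v d -> Cn l d v.
Proof.
move=> hC2; elim: l => // l IH; rewrite ltnS leq_eqVlt => /orP[/eqP <-|l1].
  exact: C2_large_weight.
(* Since a + b + 2l - 2 = d, the second bound gives a + b > 2K, so that a or b exceeds [K]. *)
have [K hK] := IH l1; exists (Num.max K (2 * K + 2 * l%:Z - 2)) => d v dK hv.
have l0 : (0 < l)%N by apply: ltnW.
have : Cn l d v by apply: hK => //; lia.
apply: hull_sub => x [u [w [a [b [hu hw e ->]]]]].
have hS := Cn_subspace l.+1 d.
case: (ltrP K a) => aK.
  move: (hK _ _ aK hu); apply: (@hull_min _ _ (fun u => Cn l.+1 d (Y u _ w))).
    exact: (subspace_preim (Y_linl _ _) hS).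
  move=> y [u1 [u2 [a1 [a2 [h1 h2 e' ->]]]]].
  by apply: Cn_iter h1 h2 hw _ => //; lia.
case: (ltrP K b) => bK.
  move: (hK _ _ bK hw); apply: (@hull_min _ _ (fun w => Cn l.+1 d (Y u _ w))).
    exact: (subspace_preim (Y_linr _ _) hS).
  move=> y [u1 [u2 [a1 [a2 [h1 h2 e' ->]]]]].
  by apply: Cn_square hu h1 h2 _ => //; lia.
lia.
Qed.

End VOSA.

(** * Words in the modes of a weak twisted module *)

Section Automorphism.
Variables (V : lmodType CC) (Y : V -> int -> V -> V) (vac om : V).
Hypothesis HV : is_VOSA Y vac om.
Variables (g : V -> V) (T : nat).
Hypothesis Hg : is_automorphism Y vac om g.
Hypothesis Tg : order_of g T.

Local Notation hom := (homw Y om).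
Local Notation eig := (eigsp g T).

Lemma ord_gt0 : (0 < T)%N. Proof. by case: Tg. Qed.

Lemma g_lin : linearf g. Proof. by case: Hg. Qed.

Lemma g_Y u n v : g (Y u n v) = Y (g u) n (g v).
Proof. by case: Hg => _ [_ [_ [_ h]]]. Qed.

Lemma g_om : g om = om. Proof. by case: Hg => _ [_ [_ [h _]]]. Qed.

Lemma eig_subspace r : subspace (eig r). Proof. exact: (eigsp_subspace T g_lin r). Qed.

Lemma eig_cong (r s : int) v : (T %| r - s)%Z -> eig r v -> eig s v.
Proof. exact: (eigsp_cong ord_gt0). Qed.

Lemma eig_om : eig 0 om.
Proof. by rewrite /eigsp g_om oppr0 expr0z scale1r. Qed.

Lemma eig_Y r s u v n : eig r u -> eig s v -> eig (r + s) (Y u n v).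
Proof.
rewrite /eigsp g_Y => -> ->.
rewrite (linfZ (Y_linl HV _ _)) (linfZ (Y_linr HV _ _)) scalerA opprD.
by rewrite exprzDr // unitfE zeta_neq0 // ord_gt0.
Qed.

Lemma hom_g v d : hom v d -> hom (g v) d.
Proof.
by move=> /homE h; apply/homE; rewrite -{1}g_om -g_Y h (linfZ g_lin).
Qed.

Lemma hom_eig_hull v d : hom v d ->
  hull (fun y => hom y d /\ exists r : int, eig r y) v.
Proof.
move=> hv; case: Tg => T0 [gT _].
apply: (eigen_hull T0 g_lin gT (hom_subspace HV d)) => // x; exact: hom_g.
Qed.

(** The twisted Jacobi identity needs its first vector to be a g-eigenvector, so the generators of
    C_l(V) are taken to be eigenvectors. *)
Lemma Cn_eig l d v : Cn Y om l d v ->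
  hull (fun x => exists u w a b r s, [/\ hom u a /\ hom w b, eig r u /\ eig s w,
     a + b + 2 * l%:Z - 2 = d & x = Y u (- l%:Z) w]) v.
Proof.
apply: hull_sub => x [u [w [a [b [hu hw e ->]]]]].
set S := hull _; have hS : subspace S by apply: hull_subspace.
have := hom_eig_hull hu; apply: (@hull_min _ _ (fun u => S (Y u _ w))).
  exact: (subspace_preim (Y_linl HV _ _) hS).
move=> {hu} {}u [hu [r ru]].
have := hom_eig_hull hw; apply: (@hull_min _ _ (fun w => S (Y u _ w))).
  exact: (subspace_preim (Y_linr HV _ _) hS).
move=> {hw} {}w [hw [s sw]].
by apply: hull_gen; exists u, w, a, b, r, s; split.
Qed.

End Automorphism.

Section Twisted.
Variables (V : lmodType CC) (Y : V -> int -> V -> V) (vac om : V).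
Hypothesis HV : is_VOSA Y vac om.
Variables (g : V -> V) (T : nat).
Hypothesis Hg : is_automorphism Y vac om g.
Hypothesis Tg : order_of g T.
Variables (M : lmodType CC) (YM : V -> int -> M -> M).
Hypothesis HM : is_weak_twisted Y vac om g T YM.

Local Notation hom := (homw Y om).
Local Notation eig := (eigsp g T).
Local Notation par a := (~~ (2 %| a)%Z).

Lemma YM_linl k w : linearf (fun u => YM u k w).
Proof. by case: HM => h _ a u v; apply: h. Qed.

Lemma YM_linr u k : linearf (YM u k).
Proof. by case: HM => _ [h _]. Qed.

Lemma YM_eig0 r v k w : eig r v -> ~~ (T %| k - r)%Z -> YM v k w = 0.
Proof. by case: HM => _ [_ [h _]]; apply: h. Qed.

Lemma YM_trunc v w : exists N : int, forall k, N <= k -> YM v k w = 0.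
Proof. by case: HM => _ [_ [_ [h _]]]. Qed.

Lemma YM_vac k w : YM vac k w = if k == - T%:Z then w else 0.
Proof. by case: HM => _ [_ [_ [_ [h _]]]]. Qed.

Lemma YM_jacobi u v a b km (kn l : int) w : hom u a -> hom v b -> eig km u ->
  exists N : nat, forall B : nat, (N <= B)%N ->
    \sum_(i < B) binC (km%:~R / T%:R) i *:
        YM (Y u (l + i%:Z) v) (km + kn - i%:Z * T%:Z) w =
    \sum_(i < B) ((-1) ^+ i * binC l%:~R i) *:
        (YM u (km + (l - i%:Z) * T%:Z) (YM v (kn + i%:Z * T%:Z) w)
         - (eps (par a) (par b) * (-1) ^ l) *:
             YM v (kn + (l - i%:Z) * T%:Z) (YM u (km + i%:Z * T%:Z) w)).
Proof.
move=> /(hom_parity) pu /(hom_parity) pv eu.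
case: HM => _ [_ [_ [_ [_ h]]]].
by apply: h eu pu pv _ _ _ _ _; rewrite subrr dvdz0.
Qed.

(** The derivative formula follows from the Jacobi identity with [vac] as second vector and l = -2,
    since L(-1)u = u(-2)1. The eigenvector is relabelled by k + 2T to place the modes. *)
Lemma YM_der u a k w : hom u a -> eig k u ->
  YM (Y om 0 u) (k + T%:Z) w = - ((k + T%:Z)%:~R / T%:R) *: YM u k w.
Proof.
move=> hu eu; have T0 := ord_gt0 Tg.
have eu' : eig (k + T%:Z * 2) u.
  by apply: (eig_cong Tg) eu; apply/dvdzP; exists (-2); ring.
have [N hN] := YM_jacobi (- T%:Z) (-2) w hu (vac_hom HV) eu'.
have := hN N.+2 (leqW (leqW (leqnn N))).
rewrite big_ord_recl big_ord_recl big1 => [|i _]; last first.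
  by rewrite (Y_vac0 HV) ?(linf0 (YM_linl _ _)) ?scaler0 //= /bump /=; lia.
rewrite [RHS]big_ord_recl big1 => [|i _]; last first.
  rewrite !YM_vac !ifN ?(linf0 (YM_linr _ _)) ?scaler0 ?subr0 ?scaler0 //;
  by apply/eqP => /=; rewrite /bump /=; nia.
have -> : Y u (-2 + (ord0 : 'I_N.+2)%:Z) vac = Y om 0 u.
  by rewrite -[RHS](Y_create HV) (Y_der HV) opprK scale1r.
have -> : Y u (-2 + (lift ord0 ord0 : 'I_N.+2)%:Z) vac = u by rewrite -[RHS](Y_create HV).
rewrite !YM_vac -[nat_of_ord ord0]/0%N -[nat_of_ord (lift _ _)]/1%N !binC0 binC1.
rewrite expr0 !mul1r !scale1r !addr0.
have -> : k + T%:Z * 2 - T%:Z = k + T%:Z by ring.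
have -> : k + T%:Z - T%:Z = k by ring.
have -> : k + T%:Z * 2 + -2 * T%:Z = k by ring.
rewrite eqxx ifN; last by apply/eqP; lia.
rewrite scaler0 subr0 => /(canRL (addrK _)) ->.
have Tn : (T%:R : CC) != 0 by rewrite pnatr_eq0 -lt0n.
rewrite -{1}[YM u k w]scale1r -scalerBl; congr (_ *: _).
by rewrite !rmorphD rmorphM /=; field.
Qed.

(** The mode with index k sees only the component of [v] in V^k, since modes of the other components
    vanish. Every mode of a homogeneous vector is thus a mode of an eigenvector matching k. *)
Lemma letter_of v d k : hom v d -> exists v', [/\ hom v' d, eig k v' &
  forall w, YM v k w = YM v' k w].
Proof.
move=> hv; have := hom_eig_hull HV Hg Tg hv.
apply: (@hull_min _ _ (fun v => exists v', [/\ hom v' d, eig k v' & forall w,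
    YM v k w = YM v' k w])).
  split=> [|c x y [x' [h1 e1 E1]] [y' [h2 e2 E2]]].
    exists 0; split=> //; first exact: (hom0 HV).
    exact: subspace0 (eig_subspace T Hg k).
  exists (c *: x' + y'); split.
  - by case: (hom_subspace HV d) => _; apply.
  - by case: (eig_subspace T Hg k) => _; apply.
  - by move=> w; rewrite !(YM_linl k w) E1 E2.
move=> y [hy [r er]].
case: (boolP (T%:Z %| k - r)%Z) => dv.
  exists y; split=> //; apply: (eig_cong Tg) er.
  by rewrite -opprB dvdzE abszN -dvdzE.
exists 0; split; [exact: (hom0 HV) | exact: subspace0 (eig_subspace T Hg k) |].
by move=> w; rewrite (YM_eig0 w er) // (linf0 (YM_linl _ _)).
Qed.

Definition delta (d k : int) : CC := d%:~R / 2%:R - k%:~R / T%:R - 1.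

Lemma LM0_comm v d k w : hom v d ->
  LM0 om T YM (YM v k w) = YM v k (LM0 om T YM w) + delta d k *: YM v k w.
Proof.
move=> /(letter_of k) [v' [hv ev E]]; rewrite !E {E v}.
have T0 := ord_gt0 Tg.
have eo : eig T%:Z om.
  by apply: (eig_cong Tg) (eig_om T Hg); apply/dvdzP; exists (-1); ring.
have [N hN] := YM_jacobi k 0 w (om_hom HV) hv eo.
have := hN N.+2 (leqW (leqW (leqnn N))).
rewrite big_ord_recl big_ord_recl big1 => [|i _]; last first.
  rewrite -[T%:Z%:~R]/(T%:R : CC) divff ?pnatr_eq0 -?lt0n //.
  by rewrite (@binC_nat0 1) // scale0r.
rewrite [RHS]big_ord_recl big1 => [|i _]; last first.
  by rewrite (@binC_nat0 0) // mulr0 scale0r.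
have -> : eps (par (4 : int)) (par d) = 1 by rewrite /eps expr0.
have -> : Y om (0 + (ord0 : 'I_N.+2)%:Z) v' = Y om 0 v' by [].
have -> : Y om (0 + (lift ord0 ord0 : 'I_N.+2)%:Z) v' = (d%:~R / 2%:R) *: v'.
  by rewrite -(homE Y om v' d).1.
rewrite -[nat_of_ord ord0]/0%N -[nat_of_ord (lift _ _)]/1%N !binC0 binC1.
rewrite -[T%:Z%:~R]/(T%:R : CC) divff ?pnatr_eq0 -?lt0n //.
rewrite expr0 expr0z !mul1r !scale1r !addr0 [T%:Z + k]addrC addrK.
rewrite (linfZ (YM_linl _ _)) (YM_der _ hv ev) /LM0 => /esym/(canRL (subrK _)) ->.
rewrite [RHS]addrC -scalerDl; congr (_ *: _ + _).
have Tn : (T%:R : CC) != 0 by rewrite pnatr_eq0 -lt0n.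
by rewrite /delta rmorphD /=; field.
Qed.

Local Notation L0 := (LM0 om T YM).

Lemma L0_lin : linearf L0.
Proof. exact: YM_linr. Qed.

(* A letter [(v, d, k)] stands for the mode v(k/T) of a vector of weight d/2. *)
Definition vec (a : V * int * int) := a.1.1.
Definition wt (a : V * int * int) := a.1.2.
Definition md (a : V * int * int) := a.2.

Definition wval (y : M) (x : seq (V * int * int)) : M :=
  foldr (fun a y => YM (vec a) (md a) y) y x.

Lemma wval_cat y x x' : wval y (x ++ x') = wval (wval y x') x.
Proof. by rewrite /wval foldr_cat. Qed.

Lemma wval_lin x : linearf (fun y => wval y x).
Proof. by elim: x => [|b x IH] c y z //=; rewrite IH YM_linr. Qed.

(* The degree d/2 - k/T - 1 of the mode, in units of 1/(2T). *)
Definition letter_deg a : int := T%:Z * wt a - 2 * md a - 2 * T%:Z.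
Definition deg x : int := \sum_(a <- x) letter_deg a.

Lemma deg_cat x y : deg (x ++ y) = deg x + deg y.
Proof. exact: big_cat. Qed.

Lemma deg_cons a x : deg (a :: x) = T%:Z * wt a - 2 * md a - 2 * T%:Z + deg x.
Proof. exact: big_cons. Qed.

Variable d0 : int.
Hypothesis d0P : forall (d : int) v, d < d0 -> hom v d -> v = 0.

(* [eig (md a)] says that v lies in V^r for r = k modulo T, as the mode v(k/T)
   requires. *)
Definition valid a := [/\ hom (vec a) (wt a), eig (md a) (vec a) & d0 <= wt a].
Definition vword (x : seq (V * int * int)) := forall a, a \in x -> valid a.

Lemma vword_cat x y : vword (x ++ y) <-> vword x /\ vword y.
Proof.
split=> [h|[h1 h2] b]; last by rewrite mem_cat => /orP[/h1|/h2].
by split=> b hb; apply: h; rewrite mem_cat hb ?orbT.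
Qed.

Lemma vword_cons a y : vword (a :: y) <-> valid a /\ vword y.
Proof.
split=> [h|[h1 h2] b]; last by rewrite inE => /orP[/eqP ->|/h2].
by split=> [|b hb]; apply: h; rewrite inE ?eqxx ?hb ?orbT.
Qed.

(** * Reduction of words to bounded weights and distinct modes *)

Section Spanning.
Variables (N2 : int) (K : int) (l : nat) (w0 : M) (L : int).
Hypothesis N2_gt0 : 0 < N2.
Hypothesis N2P : 1 <= d0 + N2.
(** For u, w of doubled weights a, b, a mode of u(-l)w has size a + b + 2l - 2 + N2, and the letters
    u, w together have size a + b + 2 N2. The inequality makes the pair smaller. *)
Hypothesis lP : N2 + 2 < 2 * l%:Z.
Hypothesis KP : forall (d : int) v, K < d -> hom v d -> Cn Y om l d v.
Hypothesis LP : forall (d : int) v (k : int), d <= K -> L < k -> hom v d -> YM v k w0 = 0.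

(* The shift [N2] makes letters positive although V may have negative weights. *)
Definition letter_size (a : V * int * int) : int := wt a + N2.
Definition wsize x : int := \sum_(a <- x) letter_size a.

Lemma wsize_cat x y : wsize (x ++ y) = wsize x + wsize y.
Proof. exact: big_cat. Qed.

Lemma wsize_cons a x : wsize (a :: x) = wt a + N2 + wsize x.
Proof. exact: big_cons. Qed.

Definition good (x : seq (V * int * int)) :=
  [/\ vword x, forall a, a \in x -> wt a <= K /\ md a <= L & uniq (map md x)].

Definition good_span s : M -> Prop :=
  hull (fun y => exists x, [/\ good x, deg x = s & y = wval w0 x]).

Lemma good_span_sub s : subspace (good_span s).
Proof. exact: hull_subspace. Qed.

Lemma good_span0 s : good_span s 0.
Proof. exact: subspace0 (good_span_sub s). Qed.

Definition reducible (n : int) :=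
  forall x, vword x -> wsize x < n -> good_span (deg x) (wval w0 x).

(** Disposes of an error term in the middle of a word. The weight of [z] may fall below [d0], where
    the letter would not be valid, but then [z] is zero. *)
Lemma reducible1 n a c z e k s : reducible n -> vword a -> vword c ->
  hom z e -> eig k z -> wsize a + wsize c + (e + N2) < n ->
  s = deg a + deg c + (T%:Z * e - 2 * k - 2 * T%:Z) ->
  good_span s (wval (YM z k (wval w0 c)) a).
Proof.
move=> red va vc hz ez lt ->.
case: (ltrP e d0) => [/d0P /(_ hz) ->|ed].
  by rewrite (linf0 (YM_linl _ _)) (linf0 (wval_lin _)); apply: good_span0.
have := red (a ++ (z, e, k) :: c).
rewrite wval_cat wsize_cat wsize_cons deg_cat deg_cons /= /wt /md /= => h.
have -> : deg a + deg c + (T%:Z * e - 2 * k - 2 * T%:Z) =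
    deg a + (T%:Z * e - 2 * k - 2 * T%:Z + deg c) by ring.
apply: h; last by lia.
by apply/vword_cat; split=> //; apply/vword_cons.
Qed.

Lemma reducible2 n a c z e k z' e' k' s : reducible n -> vword a -> vword c ->
  hom z e -> eig k z -> hom z' e' -> eig k' z' ->
  wsize a + wsize c + (e + N2) + (e' + N2) < n ->
  s = deg a + deg c + (T%:Z * e - 2 * k - 2 * T%:Z)
        + (T%:Z * e' - 2 * k' - 2 * T%:Z) ->
  good_span s (wval (YM z k (YM z' k' (wval w0 c))) a).
Proof.
move=> red va vc hz ez hz' ez' lt ->.
case: (ltrP e' d0) => [/d0P /(_ hz') ->|ed].
  rewrite (linf0 (YM_linl _ _)) (linf0 (YM_linr _ _)) (linf0 (wval_lin _)).
  exact: good_span0.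
apply: (@reducible1 n a ((z', e', k') :: c) z e k) => //.
- by apply/vword_cons.
- by rewrite wsize_cons /wt /=; lia.
- by rewrite deg_cons /wt /md /=; ring.
Qed.

Lemma eig_shift k i v : eig k v -> eig (k + i * T%:Z) v.
Proof. by apply: (eig_cong Tg); apply/dvdzP; exists (- i); ring. Qed.

Lemma ctx_sub a s : subspace (fun y => good_span s (wval y a)).
Proof. exact: (subspace_preim (wval_lin a) (good_span_sub s)). Qed.

(* The iterate formula trades u(-l)w for pairs of letters; these have smaller
   size since [l] is large compared with [N2]. *)
Lemma reducible_heavy n a x c : reducible n -> vword (a ++ x :: c) ->
  wsize (a ++ x :: c) <= n -> K < wt x ->
  good_span (deg (a ++ x :: c)) (wval w0 (a ++ x :: c)).
Proof.
case: x => [[v d] k] red /vword_cat [va /vword_cons [[hv ev dv] vc]].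
rewrite /vec /wt /md /= in hv ev dv *.
rewrite wsize_cat wsize_cons deg_cat deg_cons wval_cat /= /wt /md /vec /= => lt dK.
set s := deg a + _; have hS := ctx_sub a s.
have := Cn_eig HV Hg Tg (KP dK hv).
apply: (@hull_min _ _ (fun v => good_span s (wval (YM v k (wval w0 c)) a))).
  exact: (subspace_preim (YM_linl k _) hS).
move=> {hv ev} _ [u [w [b1 [b2 [r [r' [[hu hw] [eu ew] e ->]]]]]]].
case: (boolP (T%:Z %| k - (r + r'))%Z) => dv'; last first.
  rewrite (YM_eig0 _ (eig_Y HV Hg Tg _ eu ew) dv') (linf0 (wval_lin _)).
  exact: good_span0.
have {}ew : eig (k - r) w.
  apply: (eig_cong Tg) ew.
  by rewrite -opprB dvdzE abszN -dvdzE -addrA -opprD.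
have [N hN] := YM_jacobi (k - r) (- l%:Z) (wval w0 c) hu hw eu.
have := hN N.+1 (leqnSn N); rewrite big_ord_recl.
set R := \sum_(i < N.+1) _; set R' := \sum_(i < N) _ => E.
have SR : good_span s (wval R a).
  apply: (subspace_sum (S := fun y => good_span s (wval y a)) _ hS) => i _.
  apply: (subspaceZ _ hS); apply: (subspaceB hS).
    apply: (reducible2 red va vc hu _ hw _ ); [exact: eig_shift | exact:
        eig_shift | lia|].
    rewrite /s; nia.
  apply: (subspaceZ _ hS).
  apply: (reducible2 red va vc hw _ hu _ ); [exact: eig_shift | exact: eig_shift | lia|].
  rewrite /s; nia.
have SR' : good_span s (wval R' a).
  apply: (subspace_sum (S := fun y => good_span s (wval y a)) _ hS) => i _.
  apply: (subspaceZ _ hS).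
  apply: (reducible1 red va vc (hom_Y HV _ hu hw)).
  - rewrite -mulNr; apply: eig_shift; exact: (eig_Y HV Hg Tg).
  - rewrite /= /bump /=; lia.
  - rewrite /s /= /bump /=; nia.
rewrite -E in SR; move: SR; rewrite (subspaceDr _ hS) //.
rewrite binC0 scale1r -[nat_of_ord ord0]/0%N addr0 mul0r subr0.
by have -> : r + (k - r) = k by ring.
Qed.

Lemma eps_neq0 b1 b2 : eps b1 b2 != 0.
Proof. by rewrite /eps expf_neq0 // oppr_eq0 oner_eq0. Qed.

(** The supercommutator is a sum of modes of u(i)v with i >= 0, whose size is smaller by N2 + 2 + 2i
    than that of the two letters. The sign [eps] is invertible, hence an equivalence. *)
Lemma reducible_swap n a x y c : reducible n -> vword (a ++ x :: y :: c) ->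
  wsize (a ++ x :: y :: c) <= n ->
  good_span (deg (a ++ x :: y :: c)) (wval w0 (a ++ x :: y :: c)) <->
  good_span (deg (a ++ y :: x :: c)) (wval w0 (a ++ y :: x :: c)).
Proof.
case: x y => [[u d] k] [[v d'] k'] red /vword_cat [va /vword_cons [[hu eu du]
    /vword_cons [[hv ev dv] vc]]].
rewrite /vec /wt /md /= in hu eu du hv ev dv *.
rewrite wsize_cat !wsize_cons !deg_cat !deg_cons !wval_cat /= /wt /md /vec /= => lt.
set s := deg a + _; set s' := deg a + _; have -> : s' = s by rewrite /s /s'; ring.
have hS := ctx_sub a s.
have [N hN] := YM_jacobi k' 0 (wval w0 c) hu hv eu.
have := hN N.+1 (leqnSn N); set R := \sum_(i < N.+1) _.
rewrite big_ord_recl big1 => [|i _]; last first.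
  by rewrite (@binC_nat0 0) // mulr0 scale0r.
have SR : good_span s (wval R a).
  apply: (subspace_sum (S := fun y => good_span s (wval y a)) _ hS) => i _.
  apply: (subspaceZ _ hS).
  apply: (reducible1 red va vc (hom_Y HV _ hu hv)).
  - rewrite -mulNr; apply: eig_shift; exact: (eig_Y HV Hg Tg).
  - lia.
  - rewrite /s /=; nia.
rewrite -[nat_of_ord ord0]/0%N binC0 expr0 mul1r scale1r expr0z mulr1 !addr0 => E.
rewrite E in SR; set e := eps _ _ in SR.
have en : e != 0 by apply: eps_neq0.
split=> h.
  have := subspaceB hS h SR; rewrite subKr => h'.
  by have := subspaceZ e^-1 hS h'; rewrite scalerA mulVf // scale1r.
by have := subspaceD hS SR (subspaceZ e hS h); rewrite subrK.
Qed.

Lemma reducible_move n a x b c : reducible n -> vword (a ++ x :: b ++ c) ->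
  wsize (a ++ x :: b ++ c) <= n ->
  good_span (deg (a ++ x :: b ++ c)) (wval w0 (a ++ x :: b ++ c)) <->
  good_span (deg (a ++ b ++ x :: c)) (wval w0 (a ++ b ++ x :: c)).
Proof.
move=> red; elim: b a => [|y b IH] a //= vw lt.
rewrite (reducible_swap red) //.
have e z : a ++ y :: z = (a ++ [:: y]) ++ z by rewrite -catA.
rewrite e (e (b ++ _)); apply: IH.
  move=> z hz; apply: vw; move: hz; rewrite !mem_cat !inE.
  by case: (z \in a); case: (z == y); case: (z == x); rewrite ?orbT //= !mem_cat.
by move: lt; rewrite !wsize_cat !wsize_cons !wsize_cat /wsize big_nil; lia.
Qed.

(** A letter of weight at most [K] and mode above [L] is moved to the right end, where it
    annihilates [w0]. *)
Lemma reducible_high n a x b : reducible n -> vword (a ++ x :: b) ->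
  wsize (a ++ x :: b) <= n -> L < md x ->
  good_span (deg (a ++ x :: b)) (wval w0 (a ++ x :: b)).
Proof.
move=> red vw lt kL; case: (ltrP K (wt x)) => [|xK].
  exact: (reducible_heavy red).
rewrite -[b]cats0 (reducible_move red) ?cats0 // !wval_cat /=.
have [_ /vword_cons [[hx _ _] _]] := (vword_cat _ _).1 vw.
rewrite (LP xK kL hx) !(linf0 (wval_lin _)); exact: good_span0.
Qed.

Definition gap_sum (x : seq (V * int * int)) : int := \sum_(a <- x) (L - md a).
Definition gap_sqsum (x : seq (V * int * int)) : int := \sum_(a <- x) (L - md a) ^+ 2.

Lemma gap_sum_cat x y : gap_sum (x ++ y) = gap_sum x + gap_sum y.
Proof. exact: big_cat. Qed.

Lemma gap_sum_cons a x : gap_sum (a :: x) = L - md a + gap_sum x.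
Proof. exact: big_cons. Qed.

Lemma gap_sqsum_cat x y : gap_sqsum (x ++ y) = gap_sqsum x + gap_sqsum y.
Proof. exact: big_cat. Qed.

Lemma gap_sqsum_cons a x : gap_sqsum (a :: x) = (L - md a) ^+ 2 + gap_sqsum x.
Proof. exact: big_cons. Qed.

(** For nonnegative gaps the sum of squares is at most the square of the sum. *)
Lemma gap_sqsum_le x : (forall a, a \in x -> md a <= L) -> 0 <= gap_sum x /\
    gap_sqsum x <= gap_sum x ^+ 2.
Proof.
elim: x => [|a x IH] h; first by rewrite /gap_sum /gap_sqsum !big_nil.
have [|h1 h2] := IH; first by move=> b bx; apply: h; rewrite inE bx orbT.
have := h a (mem_head _ _); rewrite gap_sum_cons gap_sqsum_cons; nia.
Qed.

(* The Jacobi identity at l = -1 gives u(k)v(k) = - sum of u(k-j)v(k+j) and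
   v(k-j)u(k+j), j > 0, up to words of smaller size: the modes move apart. *)
Lemma reducible_pair n a u v d d' k c : reducible n ->
  vword (a ++ (u, d, k) :: (v, d', k) :: c) ->
  wsize (a ++ (u, d, k) :: (v, d', k) :: c) <= n ->
  (forall x, vword x -> wsize x <= n ->
     gap_sum x = gap_sum (a ++ (u, d, k) :: (v, d', k) :: c) ->
     gap_sqsum (a ++ (u, d, k) :: (v, d', k) :: c) < gap_sqsum x ->
     good_span (deg x) (wval w0 x)) ->
  good_span (deg (a ++ (u, d, k) :: (v, d', k) :: c))
        (wval w0 (a ++ (u, d, k) :: (v, d', k) :: c)).
Proof.
move=> red vw lt spread.
have [va /vword_cons [[hu eu du] /vword_cons [[hv ev dv] vc]]] := (vword_cat _ _).1 vw.
rewrite /vec /wt /md /= in hu eu du hv ev dv.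
set s := deg _ in spread *.
have es : s = deg a + (T%:Z * d - 2 * k - 2 * T%:Z + (T%:Z * d' - 2 * k - 2 * T%:Z +
    deg c)).
  by rewrite /s deg_cat !deg_cons.
have T0 := ord_gt0 Tg.
have hS := ctx_sub a s.
have pairs (j : int) u1 d1 u2 d2 : 0 < j -> hom u1 d1 -> hom u2 d2 ->
    eig k u1 -> eig k u2 -> d0 <= d1 -> d0 <= d2 -> d1 + d2 = d + d' ->
    good_span s (wval (YM u1 (k - j * T%:Z) (YM u2 (k + j * T%:Z) (wval w0 c))) a).
  move=> j0 h1 h2 e1 e2 l1 l2 ed.
  pose x := a ++ (u1, d1, k - j * T%:Z) :: (u2, d2, k + j * T%:Z) :: c.
  have -> : s = deg x.
    rewrite es /x deg_cat !deg_cons /wt /md /=; nia.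
  have -> : wval (YM u1 (k - j * T%:Z) (YM u2 (k + j * T%:Z) (wval w0 c))) a = wval w0 x.
    by rewrite /x wval_cat.
  apply: spread.
  - apply/vword_cat; split=> //; apply/vword_cons; split.
      by split=> //; rewrite -mulNr; apply: eig_shift.
    by apply/vword_cons; split=> //; split=> //; apply: eig_shift.
  - by move: lt; rewrite /x !wsize_cat !wsize_cons /wt /=; lia.
  - by rewrite /x !gap_sum_cat !gap_sum_cons /md /=; ring.
  - rewrite /x !gap_sqsum_cat !gap_sqsum_cons /md /=; have : 0 < j * T%:Z by nia.
    move: (j * T%:Z) => t t0; nia.
(* The label k + T for [u] together with l = -1 makes u(k)v(k) the leading term. The modes of
   u(i-1)v on the other side are smaller by N2 + 2i, which is positive because N2 is. *)
have [N hN] := YM_jacobi k (-1) (wval w0 c) hu hv (eig_shift 1 eu).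
have := hN N.+1 (leqnSn N); set R := \sum_(i < N.+1) _.
rewrite big_ord_recl; set R' := \sum_(i < N) _ => E.
have SR : good_span s (wval R a).
  apply: (subspace_sum (S := fun y => good_span s (wval y a)) _ hS) => i _.
  apply: (subspaceZ _ hS).
  apply: (reducible1 red va vc (hom_Y HV _ hu hv)).
  - rewrite -mulNr; apply: eig_shift; apply: (eig_Y HV Hg Tg) => //; exact: eig_shift.
  - by move: lt; rewrite wsize_cat !wsize_cons /wt /=; lia.
  - rewrite es /=; nia.
have second (i : nat) :
    good_span s (wval (YM v (k + (-1 - i%:Z) * T%:Z) (YM u (k + 1 * T%:Z + i%:Z *
    T%:Z) (wval w0 c))) a).
  have -> : k + (-1 - i%:Z) * T%:Z = k - (1 + i%:Z) * T%:Z by ring.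
  have -> : k + 1 * T%:Z + i%:Z * T%:Z = k + (1 + i%:Z) * T%:Z by ring.
  by apply: (pairs _ v d' u d) => //; rewrite addrC.
have SR' : good_span s (wval R' a).
  apply: (subspace_sum (S := fun y => good_span s (wval y a)) _ hS) => i _.
  apply: (subspaceZ _ hS); apply: (subspaceB hS); last first.
    by apply: (subspaceZ _ hS); apply: second.
  have -> : k + 1 * T%:Z + (-1 - (lift ord0 i : 'I_N.+1)%:Z) * T%:Z = k - i.+1%:Z * T%:Z.
    by rewrite /= /bump add1n; ring.
  by apply: (pairs i.+1 u d v d').
rewrite E in SR; move: SR; rewrite (subspaceDr _ hS) //.
rewrite binCN1 scale1r; set kap := eps _ _ * _ => h.
have := subspaceD hS h (subspaceZ kap hS (second 0%N)); rewrite subrK.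
rewrite wval_cat /= /vec /md /=.
have -> : k + 1 * T%:Z + (-1 - 0%:Z) * T%:Z = k by ring.
by have -> : k + 0%:Z * T%:Z = k by ring.
Qed.

Lemma not_uniq_split (x : seq (V * int * int)) : ~~ uniq (map md x) ->
  exists (a : seq (V * int * int)) (p : V * int * int) (b : seq (V * int * int))
    (q : V * int * int) (c : seq (V * int * int)),
    x = a ++ p :: b ++ q :: c /\ md p = md q.
Proof.
elim: x => [|y x IH] //=; rewrite negb_and negbK => /orP[/mapP [q]|/IH].
  by case/splitPr=> b c e; exists [::], y, b, q, c.
by move=> [a [p [b [q [c [-> e]]]]]]; exists (y :: a), p, b, q, c.
Qed.

Lemma reducible_step (n : int) : reducible n -> reducible (n + 1).
Proof.
move=> red.
have hi x : vword x -> wsize x <= n ->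
    (forall a, a \in x -> md a <= L) \/ good_span (deg x) (wval w0 x).
  case: (pselect (exists2 a, a \in x & L < md a)) => [[a ax La]|hL] vw lt; [right | left].
    by case/splitPr: ax vw lt => p q vw lt; apply: (reducible_high red).
  by move=> a ax; rewrite leNgt; apply/negP => La; apply: hL; exists a.
(* Spreading modes apart fixes [gap_sum] and increases [gap_sqsum], which is
   bounded by the square of [gap_sum] as long as no mode exceeds [L]. *)
suff main (m : nat) x : vword x -> wsize x <= n ->
    gap_sum x ^+ 2 - gap_sqsum x < m%:Z -> good_span (deg x) (wval w0 x).
  by move=> x vw lt; apply: (main (absz (gap_sum x ^+ 2 - gap_sqsum x + 1)%R)) => //; lia.
elim: m x => [|m IH] x vw lt spr; case: (hi x vw lt) => // hL.
  by have := gap_sqsum_le hL; lia.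
case: (pselect (exists2 a, a \in x & K < wt a)) => [[a ax Ka]|hK].
  by case/splitPr: ax vw lt {spr hL} => p q vw lt; apply: (reducible_heavy red).
have {}hK a : a \in x -> wt a <= K.
  by move=> ax; rewrite leNgt; apply/negP => Ka; apply: hK; exists a.
case: (boolP (uniq (map md x))) => [ux|].
  by apply: hull_gen; exists x; split=> //; split=> // a ax; split; [apply:
      hK | apply: hL].
move/not_uniq_split=> [a [[[u d] k] [b [[[v d'] k'] [c [ex]]]]]].
rewrite {1}/md /= => ek; subst k' => {hK hL}; subst x.
(* The first of the two letters of equal mode is moved next to the second; permuting letters changes
   neither [gap_sum] nor [gap_sqsum]. *)
rewrite (reducible_move red) // [a ++ b ++ _]catA.
have vw' : vword ((a ++ b) ++ (u, d, k) :: (v, d', k) :: c).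
  move=> z hz; apply: vw; move: hz; rewrite !(mem_cat, inE).
  by case: (z \in a); case: (z \in b); case: (z == (u, d, k)); rewrite ?orbT.
apply: (reducible_pair red) => //.
  by move: lt; rewrite !(wsize_cat, wsize_cons); lia.
move=> x vx sx ex qx; apply: IH => //.
have e1 : gap_sum ((a ++ b) ++ [:: (u, d, k), (v, d', k) & c]) = gap_sum (a ++ (u, d,
    k) :: b ++ (v, d', k) :: c).
  by rewrite !(gap_sum_cat, gap_sum_cons); ring.
have e2 : gap_sqsum ((a ++ b) ++ [:: (u, d, k), (v, d', k) & c]) =
    gap_sqsum (a ++ (u, d, k) :: b ++ (v, d', k) :: c).
  by rewrite !(gap_sqsum_cat, gap_sqsum_cons); ring.
by rewrite ex e1; rewrite e2 in qx; lia.
Qed.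

Lemma wval_good_span x : vword x -> good_span (deg x) (wval w0 x).
Proof.
have red (n : nat) : reducible n%:Z.
  elim: n => [|n IH]; last by rewrite -addn1 PoszD; apply: reducible_step.
  move=> y vy; suff : 0 <= wsize y by lia.
  rewrite /wsize big_seq; apply: sumr_ge0 => a /vy [_ _]; rewrite /letter_size; lia.
by move=> vx; apply: (red (absz (wsize x + 1)%R)) => //; lia.
Qed.

End Spanning.

(** * Finite dimension and vanishing in low degrees *)

Section Bounds.
Variables (K : int) (w0 : M) (L : int).

(** At most [n] modes with (weight, mode) in the finite list [s]. The vectors range over whole
    weight spaces, so finite dimension follows from bilinearity of the modes. *)
Fixpoint reach (s : seq (int * int)) (n : nat) : M -> Prop :=
  if n is n'.+1 then fun y => reach s n' y \/
    exists2 p, p \in s & exists v z, [/\ hom v p.1, reach s n' z & y = YM v p.2 z]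
  else fun y => y = w0.

Lemma reach_fin s n : fin_dim (reach s n).
Proof.
elim: n => [|n IH] /=; first by exists [:: w0] => y ->; apply: in_span_mem;
    rewrite mem_head.
apply: fin_dim_or => //; apply: fin_dim_bigor => p _.
apply: (@fin_dim_bilin V M M (fun u => YM u p.2)) => //.
- by move=> a u v w; apply: (YM_linl p.2 w).
- by move=> u; apply: YM_linr.
- exact: (wspace_fin HV p.1).
Qed.

Lemma reach_word s x n : vword x -> (forall a, a \in x -> (wt a, md a) \in s) ->
  (size x <= n)%N -> reach s n (wval w0 x).
Proof.
elim: x n => [|a x IH] n vx hx.
  by move=> _; elim: n => [|n IHn] //=; left.
case: n => // n; rewrite ltnS /= => lt; right.
move/vword_cons: vx => [[ha _ _] vx].
exists (wt a, md a); first by apply: hx; rewrite mem_head.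
exists (vec a), (wval w0 x); split=> //; apply: IH => // b bx.
by apply: hx; rewrite inE bx orbT.
Qed.

(** At most q+1 of the distinct numbers are at most q, and each of these contributes at least 1 -
    (q+1); every other one contributes at least 1. *)
Lemma uniq_sum_bound (es : seq nat) (q : nat) : uniq es ->
  (size es)%:Z - (q.+1 * q.+1)%:Z <= \sum_(e <- es) (2 * e%:Z - q%:Z).
Proof.
move=> ue.
have h : (size [seq e <- es | (e <= q)%N] <= q.+1)%N.
  rewrite -[X in (_ <= X)%N](size_iota 0); apply: uniq_leq_size; first exact: filter_uniq.
  by move=> e; rewrite mem_filter mem_iota add0n ltnS => /andP[].
suff : (size es)%:Z - (q.+1 * size [seq e <- es | (e <= q)%N])%:Z
    <= \sum_(e <- es) (2 * e%:Z - q%:Z) by nia.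
elim: es {ue h} => [|e es IH]; first by rewrite big_nil /=; lia.
rewrite big_cons /=; move: (\sum_(j <- es) _) IH => S.
by case: (leqP e q) => /= le; move: (size [seq _ <- _ | _]) => n; nia.
Qed.

(** Chosen so that a valid letter of mode L - e has degree at least 2e - [cutoff]. *)
Definition cutoff : nat := absz (2 * L + 2 * T%:Z - T%:Z * d0)%R.

(** Distinct modes at most [L] force all but a bounded number of letters to have positive degree.
    The degree thus bounds the length and is itself bounded below. *)
Lemma size_le_deg x : vword x -> (forall a, a \in x -> md a <= L) -> uniq (map md x) ->
  (size x)%:Z <= deg x + (cutoff.+1 * cutoff.+1)%:Z.
Proof.
move=> vx hL ux; pose f a := absz (L - md a).
have uf : uniq (map f x).
  have e : map md x = map (fun n : nat => L - n%:Z) (map f x).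
    rewrite -map_comp; apply/eq_in_map => a /hL h /=; rewrite /f; lia.
  by move: ux; rewrite e => /map_uniq.
have := uniq_sum_bound cutoff uf; rewrite size_map big_map => h.
suff h2 : \sum_(a <- x) (2 * (f a)%:Z - cutoff%:Z) <= deg x.
  by rewrite -lerBlDr; apply: le_trans h h2.
rewrite /deg big_seq [X in _ <= X]big_seq; apply: ler_sum => a ax.
have [_ _ l1] := vx a ax; have := hL a ax; rewrite /letter_deg /f /cutoff.
have : T%:Z * d0 <= T%:Z * wt a by rewrite ler_pM2l // ltz_nat (ord_gt0 Tg).
lia.
Qed.

Definition irange (a b : int) :
    seq int := [seq a + i%:Z | i <- iota 0 (absz (b - a)%R).+1].

Lemma mem_irange a b c : a <= c -> c <= b -> c \in irange a b.
Proof.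
move=> h1 h2; apply/mapP; exists (absz (c - a)%R); last by lia.
by rewrite mem_iota; lia.
Qed.

(** The degree bounds the length by [B]. Deleting a letter leaves a word whose degree is bounded
    below, so the deleted letter has degree at most [B]; this bounds its mode from below. *)
Lemma good_span_fin s : fin_dim (good_span K w0 L s).
Proof.
pose B : int := s + (cutoff.+1 * cutoff.+1)%:Z.
pose r := [seq (d, k) | d <- irange d0 K, k <- irange (L - (B + cutoff%:Z)) L].
apply/fin_dim_hull/(fin_dim_sub _ (reach_fin r (absz B))) => y [x [[vx hx ux] es ->]].
have hL a : a \in x -> md a <= L by case/hx.
apply: reach_word => //; last by have := size_le_deg vx hL ux; rewrite /B; lia.
move=> a ax; have [_ _ l1] := vx a ax; have [l2 l3] := hx a ax.
apply: allpairs_f; apply: mem_irange => //.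
case/splitPr: ax vx ux hL es {hx} => p t vx ux hL.
have vx' : vword (p ++ t).
  by move/vword_cat: vx => [v1 /vword_cons [_ v2]]; apply/vword_cat.
have ux' : uniq (map md (p ++ t)).
  by move: ux; rewrite !map_cat /= (uniq_catCA _ [:: md a]) /= => /andP[].
have hL' b : b \in p ++ t -> md b <= L.
  by move=> hb; apply: hL; move: hb; rewrite !mem_cat inE => /orP[->|->]; rewrite ?orbT.
have := size_le_deg vx' hL' ux'.
have : T%:Z * d0 <= T%:Z * wt a by rewrite ler_pM2l // ltz_nat (ord_gt0 Tg).
rewrite /B deg_cat deg_cat deg_cons /cutoff; lia.
Qed.

Lemma good_span_low (s : int) y : s < - (cutoff.+1 * cutoff.+1)%:Z ->
    good_span K w0 L s y -> y = 0.
Proof.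
move=> lt; apply: (@hull_min _ _ (fun y => y = 0)); first exact: subspace_zero.
move=> z [x [[vx hx ux] e _]].
have hL a : a \in x -> md a <= L by case/hx.
by have := size_le_deg vx hL ux; lia.
Qed.

End Bounds.

Definition words w0 s : M -> Prop :=
  hull (fun y => exists x, [/\ vword x, deg x = s & y = wval w0 x]).

Lemma words_subspace w0 s : subspace (words w0 s).
Proof. exact: hull_subspace. Qed.

(** Truncation is given vector by vector. It becomes uniform because only finitely many weights lie
    between [d0] and [K], each with a finite-dimensional space. *)
Lemma trunc_bound w0 (K : int) : exists L : int,
  forall (d : int) v (k : int), d <= K -> L < k -> hom v d -> YM v k w0 = 0.
Proof.
suff [L hL] : exists L : int, forall (d : int) v (k : int),
    d < d0 + (absz (K + 1 - d0)%R)%:Z -> L < k -> hom v d -> YM v k w0 = 0.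
  by exists L => d v k dK; apply: hL; lia.
elim: (absz _) => [|n [L hL]].
  by exists 0 => d v k; rewrite addr0 => /d0P h _ /h ->; rewrite (linf0 (YM_linl _ _)).
have [t ht] := wspace_fin HV (d0 + n%:Z).
have [L' hL'] : exists L' : int, forall v k, v \in t -> L' < k -> YM v k w0 = 0.
  elim: t {ht} => [|u t [L' IH]]; first by exists 0.
  have [N hN] := YM_trunc u w0; exists (Num.max L' N) => v k.
  by rewrite inE => /orP[/eqP -> lt|vt lt]; [apply: hN | apply: IH => //]; lia.
exists (Num.max L L') => d v k dn lt hv.
case: (eqVneq d (d0 + n%:Z)) => [ed|ne]; last by apply: (hL d) => //; lia.
rewrite ed in hv; have /in_span_hull := ht v hv.
apply: (@hull_min _ _ (fun v => YM v k w0 = 0)).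
  exact: (subspace_preim (YM_linl k w0) (subspace_zero M)).
by move=> z zt; apply: hL' => //; lia.
Qed.

Theorem words_fin_low w0 : C2_cofinite Y ->
  (forall s, fin_dim (words w0 s)) /\
  exists s0 : int, forall s y, s < s0 -> words w0 s y -> y = 0.
Proof.
(* Letters have weight at least [d0], hence size at least 1. With l = N2 + 2 both 2l > N2 + 2 and l
   > 1 hold. *)
move=> hC; pose N2 : int := Num.max 1 (1 - d0).
pose l := absz (N2 + 2).
have [|K hK] := Cn_large_weight HV hC (l := l); first by rewrite /l /N2; lia.
have [L hL] := trunc_bound w0 K.
have h s y : words w0 s y -> good_span K w0 L s y.
  apply: hull_sub => z [x [vx <- ->]].
  by apply: (wval_good_span (N2 := N2) (l := l)) => //; rewrite /l /N2; lia.
split=> [s|]; first by apply: (fin_dim_sub (@h s)); apply: good_span_fin.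
by exists (- ((cutoff L).+1 * (cutoff L).+1)%:Z) => s y lt /h; apply: good_span_low.
Qed.

End Twisted.

Lemma hull_eq0 (M : lmodType CC) (P : M -> Prop) y :
  (forall x, P x -> x = 0) -> hull P y -> y = 0.
Proof. by move=> h; apply: (@hull_min _ _ (fun y => y = 0)) => //; exact:
    subspace_zero. Qed.

Lemma hull_neq0 (M : lmodType CC) (P : M -> Prop) y :
  hull P y -> y <> 0 -> exists x, P x /\ x <> 0.
Proof.
move=> hy ny; apply: contrapT => h; apply: ny; apply: hull_eq0 hy => x Px.
by apply: contrapT => nx; apply: h; exists x.
Qed.

(** * From irreducible admissible to irreducible ordinary modules *)

Section GenEig.
Variables (M : lmodType CC) (L : M -> M).
Hypothesis lL : linearf L.

Lemma stable_zero : stable L (fun x => x = 0).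
Proof. by move=> x ->; apply: (linf0 lL). Qed.

Lemma eigspace_subspace r : subspace (fun x => L x = r *: x).
Proof.
split=> [|a y1 y2 e1 e2]; first by rewrite (linf0 lL) scaler0.
by rewrite lL e1 e2 scalerDr !scalerA mulrC.
Qed.

Lemma eig_geneig r x : L x = r *: x -> geneig L r x.
Proof. by move=> e; exists 1%N; rewrite /= /sft e subrr. Qed.

Lemma geneig_indep (I : eqType) (s : seq I) (lam : I -> CC) (f : I -> M) :
  uniq s -> {in s &, injective lam} -> (forall i, i \in s -> geneig L (lam i) (f i)) ->
  \sum_(i <- s) f i = 0 -> forall i, i \in s -> f i = 0.
Proof.
exact: (geneig_components lL (subspace_zero M) stable_zero).
Qed.

(** By independence the components of [y] at eigenvalues other than [mu] vanish. This identifies an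
    eigenspace with a span of words. *)
Lemma geneig_component (W : CC -> M -> Prop) mu y :
  (forall r, subspace (W r)) -> (forall r x, W r x -> geneig L r x) ->
  hull (fun x => exists r, W r x) y -> geneig L mu y -> W mu y.
Proof.
move=> WS Wg hy gy; case: (hull_dsum WS hy) => rs [f [urs Wf f0 ey]].
pose rs' := undup (mu :: rs).
have urs' : uniq rs' by apply: undup_uniq.
have mrs' : mu \in rs' by rewrite mem_undup mem_head.
rewrite (@big_supp _ _ rs rs') // in ey; last first.
  by move=> r h; rewrite mem_undup inE h orbT.
suff <- : f mu = y by [].
apply/eqP; rewrite -subr_eq0; apply/eqP.
have := @geneig_indep _ rs' id (fun r => if r == mu then f r - y else f r) urs'.
move=> /(_ (in2W (fun _ _ => id))) h.
have := h _ _ mu mrs'; rewrite eqxx; apply.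
  move=> r _; case: eqP => [->|_]; last exact: Wg.
  by apply: (subspaceB (geneig_subspace lL mu)) => //; apply: Wg.
rewrite (bigD1_seq mu) //= eqxx.
under eq_bigr => r /negPf ne do rewrite ne.
by rewrite addrAC -(bigD1_seq mu (F := f)) //= -ey subrr.
Qed.

End GenEig.

Section Module.
Variables (V : lmodType CC) (Y : V -> int -> V -> V) (vac om : V).
Hypothesis HV : is_VOSA Y vac om.
Variables (g : V -> V) (T : nat).
Hypothesis Hg : is_automorphism Y vac om g.
Hypothesis Tg : order_of g T.
Variable d0 : int.
Hypothesis d0P : forall (d : int) v, d < d0 -> homw Y om v d -> v = 0.
Variables (M : lmodType CC) (YM : V -> int -> M -> M).
Hypothesis HM : is_weak_twisted Y vac om g T YM.

Local Notation hom := (homw Y om).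
Local Notation eig := (eigsp g T).
Local Notation L0 := (LM0 om T YM).
Local Notation words := (words Y om g T YM d0).
Local Notation vword := (vword Y om g T d0).
Local Notation deg := (deg T).

Let L0l : linearf L0 := L0_lin HM.

Lemma words_id w : words w 0 w.
Proof. by apply: hull_gen; exists [::]; split=> //; rewrite /deg big_nil. Qed.

Lemma words_YM w s y v d k : hom v d -> words w s y ->
  words w (s + (T%:Z * d - 2 * k - 2 * T%:Z)) (YM v k y).
Proof.
move=> /(letter_of HV Hg Tg HM k) [v' [hv ev E]].
apply: hull_image; first exact: (YM_linr HM).
move=> _ [x [vx <- ->]]; rewrite E.
case: (ltrP d d0) => [/d0P /(_ hv) ->|dd].
  by rewrite (linf0 (YM_linl HM _ _)); apply: subspace0; apply: hull_subspace.
apply: hull_gen; exists ((v', d, k) :: x); split=> //.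
  by apply/vword_cons.
by rewrite deg_cons /wt /md /= addrC.
Qed.

Lemma words_L0 w s : stable L0 (words w s).
Proof.
move=> y hy; have := words_YM T%:Z (om_hom HV) hy.
by have -> : s + (T%:Z * 4 - 2 * T%:Z - 2 * T%:Z) = s by ring.
Qed.

Definition energy (s : int) : CC := s%:~R / (2 * T%:R).

Let Tn : (T%:R : CC) != 0.
Proof. by rewrite pnatr_eq0 -lt0n (ord_gt0 Tg). Qed.

Lemma delta_energy d k : delta T d k = energy (T%:Z * d - 2 * k - 2 * T%:Z).
Proof. by rewrite /delta /energy !rmorphB !rmorphM /=; field. Qed.

Lemma energy_inj : injective energy.
Proof.
move=> s t /(mulIf _) h; apply: (@intr_inj CC); apply: h.
by rewrite invr_eq0 mulf_neq0 // pnatr_eq0.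
Qed.

Lemma energyD s t : energy (s + t) = energy s + energy t.
Proof. by rewrite /energy rmorphD mulrDl. Qed.

Lemma sft_YM r v d k y : hom v d ->
  sft L0 (r + delta T d k) (YM v k y) = YM v k (sft L0 r y).
Proof.
move=> hv; rewrite /sft (LM0_comm HV Hg Tg HM k y hv) [(r + _) *:
    _]scalerDl opprD addrACA subrr addr0.
by rewrite (linfB (YM_linr HM _ _)) (linfZ (YM_linr HM _ _)).
Qed.

(** A mode of degree delta intertwines L(0) - r with L(0) - r - delta, so one exponent [n] serves
    for all words. *)
Lemma words_sft r n w s y : iter n (sft L0 r) w = 0 -> words w s y ->
  iter n (sft L0 (r + energy s)) y = 0.
Proof.
move=> wn; have lI q := iter_lin n (sft_lin L0l q).
apply: (@hull_min _ _ (fun y => iter n (sft L0 (r + energy s)) y = 0)).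
  exact: (subspace_preim (lI _) (subspace_zero M)).
move=> _ [x [vx <- ->]]; elim: x vx => [|[[v d] k] x IH] vx.
  by rewrite /deg big_nil /energy mul0r addr0.
move/vword_cons: vx => [[hv _ _] /IH h].
have -> : r + energy (deg ((v, d, k) :: x)) = r + energy (deg x) + delta T d k.
  by rewrite deg_cons energyD -delta_energy [delta _ _ _ + _]addrC; exact: addrA.
have e q z : iter n (sft L0 (q + delta T d k)) (YM v k z) = YM v k (iter n (sft L0 q) z).
  by elim: n {wn lI IH h} => [|n IHn] //=; rewrite IHn sft_YM.
by rewrite -[wval _ _ _]/(YM v k (wval YM w x)) e h (linf0 (YM_linr HM _ _)).
Qed.

Lemma words_eig r w s y : L0 w = r *: w -> words w s y -> L0 y = (r + energy s) *: y.
Proof.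
move=> e /(@words_sft r 1) /=; rewrite /sft e subrr => /(_ erefl) /eqP.
by rewrite subr_eq0 => /eqP.
Qed.

Lemma submodule_hom (W S : M -> Prop) : subspace W -> (forall w, W w -> S w) ->
  (forall v d k w, hom v d -> W w -> W (YM v k w)) -> submodule YM W S.
Proof.
move=> hW WS h; split=> //; split=> // v k w Ww.
have := hom_hull HV v; apply: (@hull_min _ _ (fun v => W (YM v k w))).
  exact: (subspace_preim (YM_linl HM k w) hW).
by move=> u [d hu]; apply: h hu Ww.
Qed.

Definition cyc (w : M) : M -> Prop := hull (fun y => exists s, words w s y).

Lemma cyc_id w : cyc w w.
Proof. by apply: hull_gen; exists 0; apply: words_id. Qed.

Lemma cyc_submodule w : submodule YM (cyc w) (fun _ => True).
Proof.
apply: submodule_hom => // [|v d k y hv]; first exact: hull_subspace.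
apply: hull_image; first exact: (YM_linr HM).
by move=> z [s hz]; apply: hull_gen; eexists; apply: words_YM hv hz.
Qed.

Lemma words_in_submodule (S S' : M -> Prop) w s y : submodule YM S S' -> S w ->
    words w s y -> S y.
Proof.
move=> [hS [_ SY]] Sw; apply: hull_min => // _ [x [_ _ ->]].
by elim: x => [|a x IH] //=; apply: SY.
Qed.

(** Independent of T' and of any grading, so it passes from a cyclic submodule to [M]; with
    C_2-cofiniteness it implies [irr_ordinary]. *)
Definition simple_eig (S : M -> Prop) : Prop :=
  [/\ submodule YM S (fun _ => True),
      forall W, submodule YM W S -> (forall w, W w -> w = 0) \/ (forall w, S w -> W w)
    & exists x r, [/\ S x, x <> 0 & L0 x = r *: x]].

Section Cofinite.
Hypothesis HC : C2_cofinite Y.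
Variable T' : nat.
Hypothesis T'0 : (0 < T')%N.

(** [S] is generated by its eigenvector [x], and words of degree s on [x] have eigenvalue
    [r + energy s]. Since [energy] is injective, each eigenspace lies in a single space
    [words x s]. *)
Lemma simple_eig_ordinary S : simple_eig S -> irr_ordinary om T T' YM S.
Proof.
move=> [Ssub Sirr [x [r [Sx xn Lx]]]]; split=> //; split; last first.
  by split=> //; exists x.
have [fd [s0 low]] := words_fin_low HV Hg Tg HM d0P x HC.
have Sgen y : S y -> cyc x y.
  have [||h] := Sirr (cyc x); last by apply: h.
    case: (cyc_submodule x) => h1 [_ h2]; split=> //; split=> // z.
    case: (Ssub) => hS _; apply: hull_min => // u [s]; exact: words_in_submodule Ssub Sx.
  by move/(_ x (cyc_id x)).
pose W mu := hull (fun y => exists s, mu = r + energy s /\ words x s y).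
have WS mu : subspace (W mu) by apply: hull_subspace.
have We mu y : W mu y -> L0 y = mu *: y.
  apply: (hull_min (eigspace_subspace L0l mu)) => z [s [-> h]].
  exact: words_eig h.
have Wg mu y : W mu y -> geneig L0 mu y by move/We/eig_geneig.
have SW y : S y -> hull (fun z => exists mu, W mu z) y.
  move/Sgen; apply: hull_mono => z [s hz]; exists (r + energy s).
  by apply: hull_gen; exists s.
have WinS mu y : W mu y -> S y.
  case: (Ssub) => hS _; apply: hull_min => // z [s [_ hz]].
  exact: words_in_submodule Ssub Sx hz.
have eW mu y : eigM om T YM S mu y -> W mu y.
  by move=> [Sy /eig_geneig]; apply: (geneig_component L0l WS Wg); apply: SW.
have eS mu : subspace (eigM om T YM S mu).
  by case: Ssub => hS _; apply: subspaceI => //; apply: eigspace_subspace.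
split; [|split].
- apply: is_dsum_intro => //; first by move=> mu y [].
    move=> y /SW; apply: hull_mono => z [mu hz]; exists mu.
    by split; [apply: WinS hz | apply: We].
  move=> ms f um hf; apply: (geneig_indep L0l (lam := id)) => //.
  by move=> mu _; apply: eig_geneig; case: (hf mu).
- move=> mu; apply: (fin_dim_sub (@eW mu)).
  case: (pselect (exists s, mu = r + energy s)) => [[s es]|ne].
    apply: (fin_dim_sub _ (fd s)) => y; apply: hull_min; first exact: words_subspace.
    move=> z [t [et hz]]; suff -> : s = t by [].
    by apply: energy_inj; apply: (addrI r); rewrite -es -et.
  apply: (fin_dim_sub _ (fin_dim_zero M)) => y; apply: hull_eq0 => z [s [e _]].
  by case: ne; exists s.
- move=> lam.
  have ex n w : eigM om T YM S (lam + n%:~R / T'%:R) w -> w <> 0 ->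
      exists s, s0 <= s /\ lam + n%:~R / T'%:R = r + energy s.
    move=> /eW hw nw; case: (hull_neq0 hw nw) => z [[s [e hz]] nz].
    by exists s; split=> //; rewrite leNgt; apply/negP => /low /(_ hz).
  case: (pselect (exists n1 s1, lam + n1%:~R / T'%:R = r + energy s1)) =>
      [[n1 [s1 e1]]|ne]; last first.
    by exists 0 => n w _ hw; apply: contrapT => nw; case: (ex n w hw nw) => s [_ e];
        apply: ne; exists n, s.
  (* From 2T (n - n1) = T' (s - s1), a smaller n would give s - s1 < -2T |s0 - s1|, hence s < s0. *)
  exists (n1 - T'%:Z * (absz (s0 - s1)%R)%:Z) => n w lt hw; apply: contrapT => nw.
  have [s [ls e]] := ex n w hw nw.
  have T'n : (T'%:R : CC) != 0 by rewrite pnatr_eq0 -lt0n.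
  have E : 2 * T%:Z * (n - n1) = T'%:Z * (s - s1).
    have : (n%:~R - n1%:~R) / T'%:R = (s%:~R - s1%:~R) / (2 * T%:R) :> CC.
      have -> : n%:~R = (r + energy s - lam) * T'%:R :> CC by rewrite -e; field.
      have -> : n1%:~R = (r + energy s1 - lam) * T'%:R :> CC by rewrite -e1; field.
      by rewrite /energy; field; rewrite T'n Tn.
    move=> h; apply: (@intr_inj CC); rewrite !rmorphM !rmorphB /=.
    have -> : n%:~R - n1%:~R = (s%:~R - s1%:~R) / (2 * T%:R) * T'%:R :> CC.
      by rewrite -h mulfVK.
    by field.
  have := ord_gt0 Tg; nia.
Qed.

(** Irreducibility is known only for graded submodules. Once L(0) acts on the degrees by distinct
    scalars, an arbitrary submodule contains the homogeneous components of its vectors, so its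
    graded part is nonzero unless it is zero itself. *)
Lemma irr_admissible_simple_eig S : irr_admissible Y om T T' YM S -> simple_eig S.
Proof.
move=> [Ssub [[w [Sw wn]] [G [[GS [Gd GY]] Girr]]]].
have T'n : (T'%:R : CC) != 0 by rewrite pnatr_eq0 -lt0n.
have [j [x [Gx xn]]] : exists j x, G j x /\ x <> 0.
  have [x [[j Gx] xn]] := hull_neq0 (is_dsum_hull Gd Sw) wn.
  by exists j, x.
have GL m z : G m z -> G m (L0 z).
  move=> Gz; have := GY om 4 T%:Z m z (om_hom HV) Gz.
  have -> : m%:R / T'%:R + 4%:~R / 2%:R - T%:Z%:~R / T%:R - 1 = m%:R / T'%:R :> CC.
    by rewrite -[T%:Z%:~R]/(T%:R : CC) divff // -[4%:~R]/(4%:R : CC); field.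
  case=> [[m' [e Gm']]|]; last by rewrite /LM0 => ->; apply: subspace0.
  suff -> : m = m' by [].
  by move/(mulIf _): e; rewrite invr_eq0 T'n => /(_ isT) /eqP; rewrite eqr_nat => /eqP.
have [y [lam [Gy yn Ly]]] : exists y lam, [/\ G j y, y <> 0 & L0 y = lam *: y].
  (* Words of degree 0 on [x] form a finite-dimensional L(0)-stable space containing [x]; nothing is
     known yet about the dimension of [G j]. *)
  have [fd _] := words_fin_low HV Hg Tg HM d0P x HC.
  have [rs e] := fin_dim_annihilator L0l (@words_L0 x 0) (fd 0) (words_id x).
  exact: (prod_eig (GS j) (GL j) Gx xn e).
(* The vectors of degree [m] on which L(0) acts by [ev m] span a graded submodule,
   so L(0) acts on all of [S] in this way. *)
pose ev (m : nat) : CC := lam + (m%:R - j%:R) / T'%:R.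
have ev_inj : injective ev.
  move=> m m' /addrI /(mulIf _); rewrite invr_eq0 T'n => /(_ isT) /addIr /eqP.
  by rewrite eqr_nat => /eqP.
pose E m z := G m z /\ L0 z = ev m *: z.
have ES m : subspace (E m) by apply: subspaceI => //; apply: eigspace_subspace.
pose gr (U : M -> Prop) := hull (fun z => exists m, U z /\ E m z).
have grU U z : submodule YM U S -> gr U z -> U z.
  by move=> [hU _]; apply: hull_min => // u [m []].
have adm U : submodule YM U S -> adm_submodule YM S G (gr U).
  move=> hU; split.
    apply: submodule_hom; first exact: hull_subspace.
      by case: (hU) => _ [US _] z /(grU _ _ hU) /US.
    move=> v d k z hv; apply: hull_image; first exact: (YM_linr HM).
    move=> u [m [Uu [Gu Lu]]].
    case: (GY v d k m u hv Gu) => [[m' [e Gm']]|->]; last first.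
      by apply: subspace0; apply: hull_subspace.
    apply: hull_gen; exists m'; split; first by case: hU => _ [_]; apply.
    split=> //; rewrite (LM0_comm HV Hg Tg HM k u hv) Lu (linfZ (YM_linr HM _ _)).
    rewrite -scalerDl; congr (_ *: _).
    rewrite /ev !mulrBl -e /delta; ring.
  apply: is_dsum_intro.
  - by move=> m; apply: subspaceI => //; apply: hull_subspace.
  - by move=> m z [].
  - move=> z; apply: hull_mono => u [m [Uu Eu]]; exists m.
    by split; [apply: hull_gen; exists m | case: Eu].
  - move=> s f us hf s0 m ms; case: Gd => _ [_ ind].
    apply: (ind s f) => //; [exact/NoDup_uniq | by move=> i; case: (hf i) | exact/In_mem].
have full U z : submodule YM U S -> U z -> z <> 0 -> gr U z -> forall w, S w -> gr U w.
  move=> hU Uz zn gz; case: (Girr _ (adm U hU)) => // h.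
  by case: zn; apply: h.
have SS : submodule YM S S by case: Ssub => h1 [_ h2]; split.
have Sy : S y by case: Gd => h _; apply: h Gy.
have SE z : S z -> hull (fun u => exists m, E m u) z.
  move=> Sz; have gy : gr S y.
    by apply: hull_gen; exists j; split=> //; split=> //; rewrite /ev subrr mul0r addr0.
  by have := full _ _ SS Sy yn gy z Sz; apply: hull_mono => u [m [_]]; exists m.
split=> //; last by exists y, lam.
move=> U hU; case: (pselect (exists u, U u /\ u <> 0)) => [[u [Uu un]]|ne]; last first.
  by left=> u Uu; apply: contrapT => un; apply: ne; exists u.
right; have Su : S u by case: hU => _ [h _]; apply: h.
case: (hull_dsum ES (SE u Su)) => s [f [us Ef f0 eu]].
have fU m : m \in s -> U (f m).
  apply: (geneig_components L0l (U := U) (lam := ev)) => //.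
  - by case: hU.
  - by move=> z Uz; case: hU => _ [_]; apply.
  - by move=> a b _ _; apply: ev_inj.
  - by move=> m' _; apply: eig_geneig; case: (Ef m').
  - by rewrite -eu.
have [m ms fn] : exists2 m, m \in s & f m <> 0.
  apply: contrapT => h; apply: un; rewrite eu big_seq big1 // => m ms.
  by apply: contrapT => fn; apply: h; exists m.
move=> z Sz; apply: (grU _ _ hU); apply: (full U (f m)) => //; first exact: fU.
by apply: hull_gen; exists m; split=> //; apply: fU.
Qed.

End Cofinite.
End Module.

(** * Submodules as modules in their own right *)

Section SubLmodule.
Variables (M : lmodType CC) (W : M -> Prop) (hW : subspace W).

(* The proof argument lets the closure instance be inferred from the predicate. *)
Definition subspace_pred (_ : subspace W) : {pred M} := fun x => `[< W x >].

Lemma subspace_pred_closed : submod_closed (subspace_pred hW).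
Proof.
split=> [|a x y]; rewrite !unfold_in.
  by apply/asboolP; apply: subspace0.
by move=> /asboolP Wx /asboolP Wy; apply/asboolP; case: hW => _; apply.
Qed.

HB.instance Definition _ := GRing.isSubmodClosed.Build CC M (subspace_pred hW)
  subspace_pred_closed.

(** Rationality speaks of modules carried by a whole [lmodType], so a cyclic submodule needs a
    carrier of its own. *)
Inductive subspace_of : predArgType := SubspaceOf u & u \in subspace_pred hW.
Definition subspace_val w : M := let: SubspaceOf u _ := w in u.

HB.instance Definition _ := [isSub of subspace_of for subspace_val].
HB.instance Definition _ := [Choice of subspace_of by <:].
HB.instance Definition _ := [SubChoice_isSubZmodule of subspace_of by <:].
HB.instance Definition _ := [SubZmodule_isSubLmodule of subspace_of by <:].

Lemma subspace_val_mem (x : subspace_of) : W (subspace_val x).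
Proof. by case: x => u h /=; apply/asboolP. Qed.

Lemma subspace_val_inj : injective subspace_val.
Proof. exact: val_inj. Qed.

Lemma subspace_val_lin : linearf (subspace_val : (subspace_of : lmodType CC) -> M).
Proof. by []. Qed.

Lemma subspace_lift y : W y -> exists x : subspace_of, subspace_val x = y.
Proof.
by move=> Wy; have h : y \in subspace_pred hW by [apply/asboolP]; exists (SubspaceOf h).
Qed.

End SubLmodule.

Section Submodule.
Variables (V : lmodType CC) (Y : V -> int -> V -> V) (vac om : V).
Variables (g : V -> V) (T : nat).
Variables (M : lmodType CC) (YM : V -> int -> M -> M).
Hypothesis HM : is_weak_twisted Y vac om g T YM.
Variable C : M -> Prop.
Hypothesis hC : submodule YM C (fun _ => True).

Let hS : subspace C := proj1 hC.
Local Notation N := (subspace_of hS).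

Lemma sub_mode_closed v k (x : N) : YM v k (subspace_val x) \in subspace_pred hS.
Proof.
by apply/asboolP; case: hC => _ [_]; apply; apply: subspace_val_mem.
Qed.

Definition sub_mode v k (x : N) : N := SubspaceOf (sub_mode_closed v k x).

Lemma sub_mode_val v k x : subspace_val (sub_mode v k x) = YM v k (subspace_val x).
Proof. by []. Qed.

Lemma sub_mode_weak : is_weak_twisted Y vac om g T (sub_mode : V -> int -> (N :
    lmodType CC) -> N).
Proof.
have vl := @subspace_val_lin M C hS; have vi := @subspace_val_inj M C hS.
case: HM => h1 [h2 [h3 [h4 [h5 h6]]]]; split; [|split; [|split; [|split; [|split]]]].
- by move=> k a u u' w; apply: vi; rewrite vl !sub_mode_val h1.
- by move=> u k a x y; apply: vi; rewrite sub_mode_val vl h2 vl.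
- move=> r v k w hv nd; apply: vi; rewrite sub_mode_val (linf0 vl); exact: h3 hv nd.
- move=> v w; have [n hn] := h4 v (subspace_val w); exists n => k nk.
  by apply: vi; rewrite sub_mode_val (linf0 vl) hn.
- move=> k w; apply: vi; rewrite sub_mode_val h5.
  by case: ifP => _ //; rewrite (linf0 vl).
- move=> u v r b1 b2 eu pu pv km kn l w dv.
  have [n hn] := h6 u v r b1 b2 eu pu pv km kn l (subspace_val w) dv.
  exists n => B nB; apply: vi; rewrite !(linf_sum vl).
  exact: hn.
Qed.

Lemma push_simple_eig (S : N -> Prop) :
  simple_eig om T (sub_mode : V -> int -> (N : lmodType CC) -> N) S ->
  simple_eig om T YM (fun m => exists x, S x /\ m = subspace_val x).
Proof.
have vl := @subspace_val_lin M C hS; have vi := @subspace_val_inj M C hS.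
move=> [[S1 [_ S2]] Sirr [x [r [Sx xn Lx]]]]; split.
- split; [|split] => //.
    split=> [|a _ _ [x1 [h1 ->]] [x2 [h2 ->]]].
      by exists 0; rewrite (linf0 vl); split=> //; apply: subspace0.
    by exists (a *: x1 + x2); split; [case: S1 => _; apply | rewrite vl].
  by move=> v k _ [z [Sz ->]]; exists (sub_mode v k z); split=> //; apply: S2.
- move=> W [W1 [W2 W3]].
  have [|h|h] := Sirr (fun z => W (subspace_val z)).
  + split; first exact: (subspace_preim vl W1).
    split=> [z Wz|v k z Wz]; last exact: W3.
    by have [z' [Sz' /vi ->]] := W2 _ Wz.
  + left=> w Ww; have [z [Sz ez]] := W2 _ Ww.
    by rewrite ez (h z) ?(linf0 vl) // -ez.
  + by right=> _ [z [Sz ->]]; apply: h.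
- exists (subspace_val x), r; split; first by exists x.
    by move=> x0; apply: xn; apply: vi; rewrite x0 (linf0 vl).
  by have := congr1 (@subspace_val M C hS) Lx; rewrite (linfZ vl).
Qed.

End Submodule.

Lemma dvd2_add (m x : int) : (2 %| x)%Z = (2 %| m)%Z -> (2 %| m + x)%Z.
Proof. lia. Qed.

(** * Degrees of nonzero modes lie in (1/T')Z *)

Section Parity.
Variables (V : lmodType CC) (Y : V -> int -> V -> V) (vac om : V).
Hypothesis HV : is_VOSA Y vac om.
Variables (g : V -> V) (T : nat) (sigma : V -> V) (T' : nat).
Hypothesis Hg : is_automorphism Y vac om g.
Hypothesis Tg : order_of g T.
Hypothesis Hs : is_parity_aut Y om sigma.
Hypothesis T'g : order_of (fun v => g (sigma v)) T'.

Lemma ordT'_gt0 : (0 < T')%N. Proof. by case: T'g. Qed.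

(** g sigma acts on [v] by (-1)^d zeta^(-k) = exp(2 pi i (d/2 - k/T)). As [v] is nonzero, the T'-th
    power of this scalar is 1, so T' (d/2 - k/T) is an integer. *)
Lemma degree_integrality v d k : homw Y om v d -> eigsp g T k v -> v <> 0 ->
  exists t : int, T'%:Z * (T%:Z * d - 2 * k - 2 * T%:Z) = 2 * T%:Z * t.
Proof.
move=> hv ev vn; pose b := ~~ (2 %| d)%Z.
have T0 := ord_gt0 Tg.
have zn : zeta T != 0 by apply: zeta_neq0.
have sv : sigma v = (-1) ^+ b *: v.
  case: Hs => _ /(_ v b (hom_parity hv)) ->; rewrite /b.
  by case: (~~ _); rewrite ?expr1 ?scaleN1r ?expr0 ?scale1r.
have gl := g_lin Hg; have sl : linearf sigma by case: Hs.
pose c : CC := (-1) ^+ b * zeta T ^ (- k).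
have it n : iter n (fun v => g (sigma v)) v = c ^+ n *: v.
  elim: n => [|n IH]; first by rewrite expr0 scale1r.
  rewrite iterS IH (linfZ sl) (linfZ gl) sv (linfZ gl) ev !scalerA exprSr mulrA //.
have c1 : c ^+ T' = 1.
  case: T'g => _ [/(_ v)]; rewrite it => e _; apply/eqP; rewrite -subr_eq0.
  have : (c ^+ T' - 1) *: v == 0 by rewrite scalerBl scale1r e subrr.
  by rewrite scaler_eq0 => /orP[|/eqP].
have zT : zeta T ^ (- k * T'%:Z) = (-1) ^+ (b * T').
  have : (-1) ^+ (b * T') * c ^+ T' = zeta T ^ (- k * T'%:Z).
    by rewrite /c exprMn -exprM mulrA -exprD addnn -mul2n exprM sqrrN !expr1n mul1r
        -exprz_exp.
  by rewrite c1 mulr1.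
(* Squaring removes the sign and yields the quotient [m] = -2kT'/T; comparing signs then shows that
   [m] has the parity of T' d. *)
have d2 : (T%:Z %| - k * T'%:Z * 2)%Z.
  rewrite -(zeta_dvd T0) -exprz_exp zT -exprnP -exprM mulnC exprM sqrrN expr1n //.
  by rewrite expr1n.
have [m em] := dvdzP d2.
have d1 : (T%:Z %| - k * T'%:Z)%Z = ~~ odd (b * T').
  rewrite -(zeta_dvd T0) zT -signr_odd; case: (odd _); rewrite ?eqxx //.
  by rewrite expr1 eq_sym -subr_eq0 opprK -mulr2n pnatr_eq0.
have par : (2 %| m + T'%:Z * d)%Z.
  have hm : (2 %| m)%Z = (T%:Z %| - k * T'%:Z)%Z.
    apply/idP/idP => [/dvdzP [q eq]|/dvdzP [q eq]].
      by apply/dvdzP; exists q; nia.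
    by apply/dvdzP; exists q; nia.
  have hd : (2 %| T'%:Z * d)%Z = (2 %| m)%Z.
    rewrite hm d1 oddM /b !dvdzE abszM Euclid_dvdM // dvdn2 orbC negb_and.
    by case: (2 %| `|d|)%N.
  exact: dvd2_add.
have [t et] := dvdzP par.
by exists (t - T'%:Z); nia.
Qed.

End Parity.

(** * Rationality and regularity *)

Section SimpleSum.
Variables (V : lmodType CC) (M : lmodType CC) (YM : V -> int -> M -> M).
Hypothesis YMl : forall v k, linearf (YM v k).
Variable D : (M -> Prop) -> Prop.
Hypothesis Dsub : forall S, D S -> submodule YM S (fun _ => True).
Hypothesis Dnz : forall S, D S -> exists x, S x /\ x <> 0.
Hypothesis Dirr : forall S, D S -> forall W, submodule YM W S ->
  (forall w, W w -> w = 0) \/ (forall w, S w -> W w).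
Hypothesis Dgen : forall w, hull (fun x => exists S, D S /\ S x) w.

Let K : eqType := {classic (M -> Prop)}.

Definition independent (A : set (M -> Prop)) : Prop :=
  (forall S, A S -> D S) /\
  forall (s : seq K) (f : K -> M), uniq s -> (forall S, S \in s -> A S /\ (S : M ->
      Prop) (f S)) ->
    \sum_(S <- s) f S = 0 -> forall S, S \in s -> f S = 0.

Lemma independent_max : exists A, independent A /\ forall B, (A `<` B)%classic ->
    ~ independent B.
Proof.
apply: Zorn_bigcup => F FI Ftot; split=> [S [X FX XS]|s f us hs s0 S Ss].
  by case: (FI X FX) => h _; apply: h.
(* Finitely many members of the union of a chain lie in one link. The list contains [S], which
   matters because the chain may be empty. *)
have [X FX hX] : exists2 X, F X & forall S, S \in s -> X S.
  have : forall S, S \in s -> (\bigcup_(X in F) X)%classic S by move=> S' /hs [].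
  elim: s S Ss {us hs s0} => // S1 s IH S Ss h.
  have [X1 FX1 hX1] := h S1 (mem_head _ _).
  case: s IH Ss h => [|S2 s] IH Ss h.
    by exists X1 => // S'; rewrite inE => /eqP ->.
  have [|X FX hX] := IH S2 (mem_head _ _).
    by move=> S' hS'; apply: h; rewrite inE hS' orbT.
  case: (Ftot X1 X FX1 FX) => sub.
    by exists X => // S'; rewrite inE => /orP[/eqP ->|/hX //]; apply: sub.
  by exists X1 => // S'; rewrite inE => /orP[/eqP -> //|/hX]; apply: sub.
case: (FI X FX) => _ ind; apply: (ind s f us) => // S' hS'.
by case: (hs S' hS') => _ h; split=> //; apply: hX.
Qed.

(** Let [HA] be the sum of a maximal independent family. An irreducible [S] meets [HA] in [S] or in
    0; in the second case [S] could be added to the family. *)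
Lemma simple_dsum : dsum_of D.
Proof.
have [A [[AD ind] Amax]] := independent_max.
pose HA := hull (fun x => exists S, A S /\ S x).
have HAs : subspace HA by apply: hull_subspace.
have HAY v k x : HA x -> HA (YM v k x).
  apply: hull_image => // y [S [AS Sy]]; apply: hull_gen; exists S; split=> //.
  by case: (Dsub (AD S AS)) => _ [_]; apply.
have DA S x : D S -> S x -> HA x.
  move=> DS Sx; have [S1 [_ S2]] := Dsub DS.
  case: (Dirr DS (W := fun z => S z /\ HA z)) => [|h|h]; last by case: (h x Sx).
    split; first exact: subspaceI.
    by split=> [z []//|v k z [Sz Hz]]; split; [apply: S2 | apply: HAY].
  case: (Amax (A `|` [set S])%classic); last split.
  - split=> [B AB|]; first by left.
    move=> sub; have AS : A S by apply: sub; right.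
    have [z [Sz nz]] := Dnz DS; apply: nz; apply: h; split=> //.
    by apply: hull_gen; exists S.
  - by move=> B [/AD //|->].
  - move=> s f us hs s0.
    case: (boolP ((S : K) \in s)) => Ss; last first.
      apply: ind => // B Bs; case: (hs B Bs) => [[AB|eB]] hB; first by split.
      by move: Ss; rewrite -eB Bs.
    have rest B : B \in s -> B != S -> A B /\ (B : M -> Prop) (f B).
      by move=> Bs ne; case: (hs B Bs) => [[AB|eB]] hB //; rewrite eB eqxx in ne.
    move: s0; rewrite (bigD1_seq (S : K)) //= => s0.
    have fS : f S = 0.
      apply: h; split; first by case: (hs S Ss).
      have -> : f S = - \sum_(i <- s | i != S) f i.
        by apply/eqP; rewrite -addr_eq0 s0.
      apply: subspaceN => //; rewrite big_seq_cond; apply: subspace_sum =>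
          // B /andP[Bs ne].
      by case: (rest B Bs ne) => AB Bf; apply: hull_gen; exists B.
    move=> B Bs; case: (eqVneq B S) => [-> //|ne].
    rewrite fS add0r -big_filter in s0.
    apply: (ind _ f _ _ s0); rewrite ?filter_uniq ?mem_filter ?ne //.
    by move=> B'; rewrite mem_filter => /andP[ne' Bs']; apply: rest.
pose I := {S : M -> Prop | A S}.
exists I, (fun i => sval i); split; first by case=> S AS; apply: AD.
apply: (@is_dsum_intro M {classic I} (fun i : I => sval i)) => //.
- by case=> S AS; case: (Dsub (AD S AS)).
- move=> x _; have := Dgen x; apply: hull_sub => y [S [DS Sy]].
  have := DA S y DS Sy; apply: hull_mono => z [S' [AS' hz]].
  by exists (exist _ S' AS').
- move=> s f us hf s0 i si.
  pose f' (S : K) : M := if pselect (A S) is left h then f (exist _ S h) else 0.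
  have ff' (j : I) : f' (sval j) = f j.
    case: j => S AS; rewrite /f' /=; case: pselect => // h.
    by rewrite (Prop_irrelevance h AS).
  pose val' (j : {classic I}) : K := sval (j : I).
  rewrite -ff'; apply: (ind (map val' s) f').
  - rewrite map_inj_uniq // => -[S1 A1] [S2 A2]; rewrite /val' /= => e.
    by move: A1 A2; rewrite e => A1 A2; rewrite (Prop_irrelevance A1 A2).
  - move=> S /mapP [j js ->]; rewrite ff'; split; last exact: hf.
    by case: j js.
  - by rewrite big_map -[RHS]s0; apply: eq_bigr => j _; rewrite ff'.
  - exact: (map_f val' si).
Qed.

End SimpleSum.

(** * The two implications *)

Section Main.
Variables (V : lmodType CC) (Y : V -> int -> V -> V) (vac om : V).
Hypothesis HV : is_VOSA Y vac om.
Variables (g : V -> V) (T : nat) (sigma : V -> V) (T' : nat).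
Hypothesis Hg : is_automorphism Y vac om g.
Hypothesis Tg : order_of g T.
Hypothesis Hs : is_parity_aut Y om sigma.
Hypothesis T'g : order_of (fun v => g (sigma v)) T'.
Variable d0 : int.
Hypothesis d0P : forall (d : int) v, d < d0 -> homw Y om v d -> v = 0.

Local Notation hom := (homw Y om).

Let Tn : (T%:R : CC) != 0.
Proof. by rewrite pnatr_eq0 -lt0n (ord_gt0 Tg). Qed.

Let T'n : (T'%:R : CC) != 0.
Proof. by rewrite pnatr_eq0 -lt0n (ordT'_gt0 T'g). Qed.

Lemma energy_div (s t : int) : T'%:Z * s = 2 * T%:Z * t -> energy T s = t%:~R / T'%:R.
Proof.
move=> e; have : T'%:R * s%:~R = 2 * T%:R * t%:~R :> CC.
  by have := congr1 (fun z : int => z%:~R : CC) e; rewrite !rmorphM.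
move=> E; rewrite /energy; have -> : s%:~R = (2 * T%:R * t%:~R) / T'%:R :> CC.
  by rewrite -E mulrC mulKf.
by field; rewrite T'n Tn.
Qed.

Section OneModule.
Variables (M : lmodType CC) (YM : V -> int -> M -> M).
Hypothesis HM : is_weak_twisted Y vac om g T YM.

Local Notation L0 := (LM0 om T YM).

Lemma YM_degree v d k w : hom v d -> YM v k w <> 0 ->
  exists t : int, T'%:Z * (T%:Z * d - 2 * k - 2 * T%:Z) = 2 * T%:Z * t.
Proof.
move=> /(letter_of HV Hg Tg HM k) [v' [hv ev E]]; rewrite E => n0.
apply: (degree_integrality Hg Tg Hs T'g hv ev) => e0.
by apply: n0; rewrite e0 (linf0 (YM_linl HM _ _)).
Qed.

Lemma irr_ordinary_admissible S : irr_ordinary om T T' YM S ->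
    irr_admissible Y om T T' YM S.
Proof.
move=> [Ssub [[Sd [Sfd Slow]] [[x [Sx xn]] Sirr]]].
have L0l := L0_lin HM.
have [y [[lam [Sy Ly]] yn]] := hull_neq0 (is_dsum_hull Sd Sx) xn.
pose ev (n : int) : CC := lam + n%:~R / T'%:R.
have ev_inj : injective ev.
  move=> m n /addrI /(mulIf _) h; apply: (@intr_inj CC); apply: h.
  by rewrite invr_eq0 T'n.
pose E n := eigM om T YM S (ev n).
have ES n : subspace (E n).
  by case: Ssub => hS _; apply: subspaceI => //; apply: eigspace_subspace.
have EY v d k n z : hom v d -> E n z -> YM v k z <> 0 ->
    exists2 t : int, delta T d k = t%:~R / T'%:R & E (n + t) (YM v k z).
  move=> hv [Sz Lz] nz; have [t et] := YM_degree hv nz.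
  have dt : delta T d k = t%:~R / T'%:R by rewrite (delta_energy Tg) (energy_div et).
  exists t => //; split; first by case: Ssub => _ [_]; apply.
  rewrite (LM0_comm HV Hg Tg HM k z hv) Lz (linfZ (YM_linr HM _ _)) -scalerDl dt.
  by congr (_ *: _); rewrite /ev rmorphD mulrDl addrA.
have [n0 low] := Slow lam.
have gen z : S z -> hull (fun u => exists n, E n u) z.
  move: z; case: (Sirr (hull (fun u => exists n, E n u))) => // [|h].
    apply: (submodule_hom HV HM); first exact: hull_subspace.
      by case: Ssub => hS _ z; apply: hull_min => // u [n []].
    move=> v d k z hv; apply: hull_image; first exact: (YM_linr HM).
    move=> u [n En]; case: (pselect (YM v k u = 0)) => [->|nz].
      by apply: subspace0; apply: hull_subspace.
    by have [t _ Et] := EY v d k n u hv En nz; apply: hull_gen; exists (n + t).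
  case: yn; apply: h; apply: hull_gen; exists 0; split=> //.
  by rewrite /ev mul0r addr0.
split=> //; split; first by exists x.
(* Degrees are counted from [n0], below which the eigenspaces of this coset vanish. *)
exists (fun j => E (n0 + j%:Z)); split; last first.
  by move=> W [hW _]; apply: Sirr.
split=> [j|]; first exact: ES.
split.
  apply: is_dsum_intro => //.
  - by move=> j z [].
  - move=> z /gen; apply: hull_sub => u [n En].
    case: (ltrP n n0) => [lt|le].
      by rewrite (low n u lt En); apply: subspace0; apply: hull_subspace.
    apply: hull_gen; exists (absz (n - n0)%R).
    by have -> : n0 + (absz (n - n0)%R)%:Z = n by lia.
  - move=> s f us hf; apply: (geneig_indep L0l (lam := fun j => ev (n0 + j%:Z))) => //.
      by move=> i j _ _ /ev_inj; lia.
    by move=> j _; apply: eig_geneig; case: (hf j).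
move=> v d k j z hv Ez.
case: (pselect (YM v k z = 0)) => [->|nz]; [by right | left].
have [t dt Et] := EY v d k _ z hv Ez nz.
have le : 0 <= j%:Z + t.
  rewrite leNgt; apply/negP => lt; apply: nz; apply: (low (n0 + j%:Z + t)) => //.
  by lia.
exists (absz (j%:Z + t)%R); split; last first.
  by have -> : n0 + (absz (j%:Z + t)%R)%:Z = n0 + j%:Z + t by lia.
have -> : (absz (j%:Z + t)%R)%:R = (j%:Z + t)%:~R :> CC.
  by rewrite -[in RHS](gez0_abs le).
rewrite rmorphD mulrDl -dt /delta; ring.
Qed.

(** Words of degree t/T', with the condition cleared of denominators. Words whose degree is not in
    (1/T')Z are left out; they have value zero. *)
Definition graded_words w (t : int) : M -> Prop :=
  hull (fun y => exists x, [/\ vword Y om g T d0 x, T'%:Z * deg T x = 2 * T%:Z * t &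
      y = wval YM w x]).

Lemma graded_words_YM w t u v d k y : hom v d ->
  T'%:Z * (T%:Z * d - 2 * k - 2 * T%:Z) = 2 * T%:Z * t ->
  graded_words w u y -> graded_words w (u + t) (YM v k y).
Proof.
move=> /(letter_of HV Hg Tg HM k) [v' [hv ev E]] et.
apply: hull_image; first exact: (YM_linr HM).
move=> _ [x [vx ex ->]]; rewrite E.
case: (ltrP d d0) => [/d0P /(_ hv) ->|dd].
  by rewrite (linf0 (YM_linl HM _ _)); apply: subspace0; apply: hull_subspace.
apply: hull_gen; exists ((v', d, k) :: x); split=> //.
  by apply/vword_cons.
by rewrite deg_cons /wt /md /= mulrDr et ex; ring.
Qed.

Lemma graded_words_sft r n w t y : iter n (sft L0 r) w = 0 -> graded_words w t y ->
  iter n (sft L0 (r + t%:~R / T'%:R)) y = 0.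
Proof.
move=> wn; have lI q := iter_lin n (sft_lin (L0_lin HM) q).
apply: (@hull_min _ _ (fun y => iter n (sft L0 (r + t%:~R / T'%:R)) y = 0)).
  exact: (subspace_preim (lI _) (subspace_zero M)).
move=> _ [x [vx ex ->]]; rewrite -(energy_div ex).
apply: (words_sft (d0 := d0) HV Hg Tg HM wn).
by apply: hull_gen; exists x.
Qed.

(** A word of nonzero value has only nonzero suffixes, so each of its letters acts as a nonzero mode
    and has degree in (1/T')Z. *)
Lemma cyc_graded_words w y : cyc Y om g T d0 YM w y -> hull (fun z => exists t,
    graded_words w t z) y.
Proof.
apply: hull_sub => z [s]; apply: hull_sub => u [x [vx _ ->]].
case: (pselect (wval YM w x = 0)) => [->|nz].
  by apply: subspace0; apply: hull_subspace.
suff [t et] : exists t : int, T'%:Z * deg T x = 2 * T%:Z * t.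
  by apply: hull_gen; exists t; apply: hull_gen; exists x.
elim: x vx nz {u} => [|[[v d] k] x IH] vx nz.
  by exists 0; rewrite /deg big_nil !mulr0.
move/vword_cons: vx => [[hv ev _] vx]; rewrite /vec /wt /md /= in hv ev.
have [|t et] := IH vx.
  by move=> e; apply: nz; rewrite /= e (linf0 (YM_linr HM _ _)).
have [t' et'] := YM_degree hv nz.
rewrite /md /= in et'.
by exists (t' + t); rewrite deg_cons /wt /md /= mulrDr et et' -mulrDr.
Qed.

Hypothesis HC : C2_cofinite Y.

Lemma graded_words_low w : exists t0 : int, forall t y, t < t0 ->
    graded_words w t y -> y = 0.
Proof.
have [_ [s0 low]] := words_fin_low HV Hg Tg HM d0P w HC.
(* From T' deg = 2 T t, such a t gives deg < -2T |s0|, which is at most [s0]. *)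
exists (- T'%:Z * (absz s0)%:Z) => t y lt; apply: hull_eq0 => z [x [vx ex ez]].
apply: (low (deg T x)); last by apply: hull_gen; exists x.
rewrite ltNge; apply/negP => le.
have := ord_gt0 Tg; have := ordT'_gt0 T'g; nia.
Qed.

(** That [w] is a generalized eigenvector makes the sum of the degrees direct: degree j consists of
    generalized eigenvectors for r + (t0 + j)/T', and these values are distinct. *)
Lemma cyc_admissible r n w
    (hC : submodule YM (cyc Y om g T d0 YM w) (fun _ => True)) :
  iter n (sft L0 r) w = 0 ->
  @admissible V Y vac om g T T' (subspace_of (proj1 hC)) (sub_mode (hC := hC)).
Proof.
move=> wn; split; first exact: (sub_mode_weak HM hC).
have vl := @subspace_val_lin M _ (proj1 hC); have vi := @subspace_val_inj M _ (proj1 hC).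
have [t0 low] := graded_words_low w.
pose G (j : nat) (z :
    subspace_of (proj1 hC)) := graded_words w (t0 + j%:Z) (subspace_val z).
have GS j : subspace (G j : (subspace_of (proj1 hC) : lmodType CC) -> Prop).
  exact: (subspace_preim vl (hull_subspace _)).
exists G; split=> //; split; last first.
  move=> v d k j z hv Gz.
  case: (pselect (sub_mode v k z = 0)) => [->|nz]; [by right | left].
  have nz' : YM v k (subspace_val z) <> 0.
    by move=> e; apply: nz; apply: vi; rewrite (linf0 vl).
  have [t et] := YM_degree hv nz'.
  have ht := graded_words_YM hv et Gz.
  have le : 0 <= j%:Z + t.
    by rewrite leNgt; apply/negP => lt; apply: nz'; apply: low ht; lia.
  exists (absz (j%:Z + t)%R); split; last first.
    by rewrite /G; have -> : t0 + (absz (j%:Z + t)%R)%:Z = t0 + j%:Z + t by lia.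
  have -> : (absz (j%:Z + t)%R)%:R = (j%:Z + t)%:~R :> CC.
    by rewrite -[in RHS](gez0_abs le).
  rewrite rmorphD mulrDl -(energy_div et) -(delta_energy Tg) /delta; ring.
apply: is_dsum_intro => //.
- move=> z _.
  have : hull (fun u => exists t, graded_words w t u) (subspace_val z).
    by apply: cyc_graded_words; apply: subspace_val_mem.
  (* The decomposition is known in [M]; [Q] lifts it to the carrier of the cyclic submodule. *)
  pose Q y := exists z' : subspace_of (proj1 hC), subspace_val z' = y /\
    hull (fun u : (subspace_of (proj1 hC) : lmodType CC) => exists j, G j u) z'.
  move/(@hull_min _ _ Q); case.
  + split=> [|a y1 y2 [z1 [<- h1]] [z2 [<- h2]]].
      exists 0; split; first by rewrite (linf0 vl).
      by apply: subspace0; apply: hull_subspace.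
    exists (a *: z1 + z2); split; first by rewrite vl.
    by case: (hull_subspace (fun u : (subspace_of (proj1 hC) : lmodType CC) =>
        exists j, G j u)) => _; apply.
  + move=> y [t hy]; case: (ltrP t t0) => [lt|le].
      exists 0; rewrite (linf0 vl) (low t y lt hy); split=> //.
      by apply: subspace0; apply: hull_subspace.
    have cy : cyc Y om g T d0 YM w y.
      move: hy; apply: hull_sub => u [x [vx _ ->]]; apply: hull_gen.
      by exists (deg T x); apply: hull_gen; exists x.
    have [z' ez'] := subspace_lift (proj1 hC) cy.
    exists z'; split=> //; apply: hull_gen; exists (absz (t - t0)%R).
    rewrite /G ez'.
    by have -> : t0 + (absz (t - t0)%R)%:Z = t by lia.
  + by move=> z' [/vi -> ].
- move=> s f us hf s0 j js; apply: vi; rewrite (linf0 vl).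
  apply: (geneig_indep (L0_lin HM) (s := s) (lam := fun j =>
      r + (t0 + j%:Z)%:~R / T'%:R) (f := fun j => subspace_val (f j))) => //.
  + move=> i i' _ _ /addrI /(mulIf _); rewrite invr_eq0 T'n =>
      /(_ isT) /(@intr_inj CC); lia.
  + by move=> i _; exists n; apply: graded_words_sft wn (hf i).
  + by rewrite -(linf_sum vl) s0 (linf0 vl).
Qed.

Lemma rational_generated : g_rational Y vac om g T T' ->
  forall w, hull (fun x => exists S, simple_eig om T YM S /\ S x) w.
Proof.
move=> rat w; have L0l := L0_lin HM.
have [fd _] := words_fin_low HV Hg Tg HM d0P w HC.
have [rs e] := fin_dim_annihilator L0l (@words_L0 _ _ _ _ HV _ _ Hg Tg _ d0P _ _ HM w
    0) (fd 0) (words_id _ _ _ _ _ _ w).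
have := prod_geneig L0l (subspace_true M) (fun _ _ => I) I e.
apply: hull_sub => y [_ [r [n yn]]].
have hC := cyc_submodule HV Hg Tg d0P HM y.
have [J [W [hW dW]]] := rat _ _ (cyc_admissible hC yn).
have [z <-] := subspace_lift (proj1 hC) (cyc_id Y om g T d0 YM y).
have vl := @subspace_val_lin M _ (proj1 hC).
apply: (hull_image vl (P := fun u => exists i, W i u)); last exact: (is_dsum_hull dW).
move=> u [i Wu]; apply: hull_gen; exists (fun m => exists x, W i x /\ m = subspace_val x).
split; last by exists u.
apply: push_simple_eig.
apply: (irr_admissible_simple_eig HV Hg Tg d0P (sub_mode_weak HM hC) HC (ordT'_gt0 T'g)).
exact: hW.
Qed.

End OneModule.

Lemma rational_regular : C2_cofinite Y ->
  g_rational Y vac om g T T' -> g_regular Y vac om g T T'.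
Proof.
move=> HC rat M YM HM.
have [I [W [hW dW]]] : dsum_of (simple_eig om T YM).
  apply: (simple_dsum (YM := YM)).
  - exact: (YM_linr HM).
  - by move=> S [].
  - by move=> S [_ _ [x [r [Sx xn _]]]]; exists x.
  - by move=> S [].
  - exact: rational_generated.
exists I, W; split=> // i.
exact: (simple_eig_ordinary HV Hg Tg d0P HM HC (ordT'_gt0 T'g)).
Qed.

Lemma regular_rational : g_regular Y vac om g T T' -> g_rational Y vac om g T T'.
Proof.
move=> reg M YM [HM _]; have [I [W [hW dW]]] := reg M YM HM.
by exists I, W; split=> // i; apply: (irr_ordinary_admissible HM).
Qed.

End Main.

Theorem theorem4p7 (V : lmodType CC) (Y : V -> int -> V -> V) (vac om : V)
    (g : V -> V) (T : nat) (sigma : V -> V) (T' : nat) :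
  is_VOSA Y vac om ->
  C2_cofinite Y ->
  is_automorphism Y vac om g ->
  order_of g T ->
  is_parity_aut Y om sigma ->
  order_of (fun v => g (sigma v)) T' ->
  (g_rational Y vac om g T T' <-> g_regular Y vac om g T T').
Proof.
move=> HV HC Hg Tg Hs T'g; have [d0 d0P] := wspace_low HV.
split; first exact: (rational_regular HV Hg Tg Hs T'g d0P HC).
exact: (regular_rational HV Hg Tg Hs T'g).
Qed.
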